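(* Let $A\in M_n(\mathbb{C})$ be a unitarily irreducible matrix whose base polynomial $F_A$ is reducible. Then there is a block diagonal matrix $A'$, with at least two diagonal blocks, which is the same size as $A$ and has the same numerical range, the same base polynomial, and the same boundary generating curve as $A$.
   Context: For $A\in M_n(\mathbb{C})$, the numerical range is $W(A)=\{\langle A\mathbf{x},\mathbf{x}\rangle : \mathbf{x}\in\mathbb{C}^n,\ \|\mathbf{x}\|=1\}\subset\mathbb{C}$. $A$ is unitarily irreducible if it is not unitarily similar to a block diagonal matrix with at least two diagonal blocks. The base polynomial of $A$ is the homogeneous polynomial $F_A(x:y:t)=\det(xH_1+yH_2+tI_n)$, where $H_1=(A+A^* )/2$ and $H_2=(A-A^* )/(2i)$; it is reducible if it is a product of two nonconstant polynomials. The boundary generating curve of $W(A)$ is the dual curve $\Gamma_F^\wedge$ of the base curve $\Gamma_{F}: F_A(x:y:t)=0$ in $\mathbb{CP}^2$. *)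

(* Defs.v *)
From mathcomp Require Import all_boot all_order all_algebra.
From mathcomp Require Import complex.
From mathcomp Require Import classical_sets reals.
From mathcomp.multinomials Require Import mpoly.

Set Implicit Arguments.
Unset Strict Implicit.
Unset Printing Implicit Defensive.

Import Order.TTheory GRing.Theory Num.Theory.
Local Open Scope ring_scope.
Local Open Scope sesquilinear_scope.
Local Open Scope classical_set_scope.

Section NumericalRange.
Variable C : numClosedFieldType.

(* The library's dotmx is for row vectors; this is its analogue for columns. *)
Definition cdot n (x y : 'cV[C]_n) : C := (y^t* *m x) ord0 ord0.

Definition cnorm n (x : 'cV[C]_n) : C := sqrtC (cdot x x).

Definition numerical_range n (A : 'M[C]_n) : set C :=
  [set cdot (A *m x) x | x in [set x : 'cV[C]_n | cnorm x = 1]].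

(* The blocks have positive size and the castmx only identifies the sum of the
   block sizes with n; the order of the basis is not changed. *)
Definition block_diagonal n (A : 'M[C]_n) : Prop :=
  exists (k : nat) (p : 'I_k -> nat) (B : forall i, 'M[C]_(p i))
         (e : (\sum_i p i)%N = n),
    [/\ (1 < k)%N, (forall i, 0 < p i)%N
      & A = castmx (e, e) (\mxdiag_(i < k) B i)].

Definition unitarily_similar n (A B : 'M[C]_n) : Prop :=
  exists2 U : 'M[C]_n, U \is unitarymx & B = U^t* *m A *m U.

Definition unitarily_irreducible n (A : 'M[C]_n) : Prop :=
  ~ exists2 B : 'M[C]_n, unitarily_similar A B & block_diagonal B.

Definition H1 n (A : 'M[C]_n) : 'M[C]_n := 2^-1 *: (A + A^t*).

Definition H2 n (A : 'M[C]_n) : 'M[C]_n := (2 * 'i)^-1 *: (A - A^t*).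

(* The variables x, y, t are those of index 0, 1, 2 in 'I_3. *)
Definition base_poly n (A : 'M[C]_n) : {mpoly C[3]} :=
  \det ('X_(inord 0) *: map_mx (@mpolyC 3 C) (H1 A)
        + 'X_(inord 1) *: map_mx (@mpolyC 3 C) (H2 A)
        + ('X_(inord 2))%:M).

Definition poly_reducible k (F : {mpoly C[k]}) : Prop :=
  exists p q : {mpoly C[k]},
    [/\ (1 < msize p)%N, (1 < msize q)%N & F = p * q].

(* A subset of the projective plane (or of its dual) is represented by the set
   of homogeneous coordinate vectors of its points: a set of nonzero vectors
   stable under nonzero scalars.  The line a x + b y + c t = 0 is the point
   (a : b : c) of the dual plane. *)
Definition zero_locus (F : {mpoly C[3]}) : set 'rV[C]_3 :=
  [set v : 'rV[C]_3 | v != 0 /\ F.@[v ord0] = 0].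

Definition vanishes_on (g : {mpoly C[3]}) (X : set 'rV[C]_3) : Prop :=
  forall v, X v -> g.@[v ord0] = 0.

Definition zariski_closure (X : set 'rV[C]_3) : set 'rV[C]_3 :=
  [set u : 'rV[C]_3 | u != 0 /\
     forall d (g : {mpoly C[3]}), g \is d.-homog -> vanishes_on g X ->
       g.@[u ord0] = 0].

Definition gradient (g : {mpoly C[3]}) (v : 'rV[C]_3) : 'rV[C]_3 :=
  \row_i (g^`M(i)).@[v ord0].

(* The vanishing ideal of a plane curve X is generated by a squarefree form f,
   so the gradients at v of the forms vanishing on X are the multiples of the
   gradient of f at v: they are all zero when X is singular at v, and otherwise
   the nonzero ones are the coordinate vectors of the tangent line at v.
   Going through the vanishing ideal makes the definition correct when X is
   given by an equation with repeated factors. *)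
Definition tangent_lines (X : set 'rV[C]_3) : set 'rV[C]_3 :=
  [set u : 'rV[C]_3 | u != 0 /\
     exists v d (g : {mpoly C[3]}),
       [/\ X v, g \is d.-homog, vanishes_on g X & u = gradient g v]].

Definition dual_curve (X : set 'rV[C]_3) : set 'rV[C]_3 :=
  zariski_closure (tangent_lines X).

Definition boundary_generating_curve n (A : 'M[C]_n) : set 'rV[C]_3 :=
  dual_curve (zero_locus (base_poly A)).

End NumericalRange.

(* Main.v *)
(** Dehomogenised at [y = 1], the base polynomial is up to sign the characteristic
    polynomial of [M = x H1 + H2], which is self-adjoint for the involution of [C[x]]
    that conjugates the coefficients.  If it factors, [M] has a proper invariant
    subspace over [C(x)], and the orthogonal projection [N / c] onto it commutes with
    [M].  A lattice over [C[x]] stable under [M] on which the Hermitian form is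
    polynomial is enlarged, one eigenvector at a time, until it is stable under
    [N / c] and the form is unimodular; each step lowers the degree of the
    discriminant.  Lowering the degrees of the diagonal entries then makes the form
    constant, hence standard in a suitable basis.  In that basis the projection
    satisfies [P P^H = P], and [tr (M M^H) = tr M^2] has degree at most 2.  Leading
    terms of sums of squared norms do not cancel, so [P] is constant and
    [M = x K1 + K2].  As [P] commutes with [K1] and [K2], the matrix [K1 + i K2] is
    unitarily similar to a block diagonal one, and its base polynomial is that of [A].

    The numerical range is determined by the base polynomial: a point [z] outside it
    is separated from it by a line, that is, some combination
    [a (H1 - Re z) + b (H2 - Im z)] is positive definite, and definiteness of a
    Hermitian matrix [S] can be read off from the values of [det (S + t)], [t >= 0]. *)
Require Import Defs.
From mathcomp Require Import all_boot all_order fingroup perm all_algebra.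
From mathcomp Require Import complex reals zify ring lra.

Set Implicit Arguments.
Unset Strict Implicit.
Unset Printing Implicit Defensive.
Import Order.TTheory GRing.Theory Num.Theory.
Local Open Scope ring_scope.
Local Open Scope sesquilinear_scope.

Local Notation pconj := (map_poly (@Num.conj _)).
Local Notation "M ^t~" := (M ^t (map_poly (@Num.conj _))) (at level 30).

(** * Sums of squared norms of polynomials *)

Lemma coefM_top (R : nzSemiRingType) (p q : {poly R}) a b :
  (size p <= a.+1)%N -> (size q <= b.+1)%N -> (p * q)`_(a + b) = p`_a * q`_b.
Proof.
move=> sp sq; rewrite coefM (bigD1 (inord a)) //= inordK ?ltnS ?leq_addr //.
rewrite addKn big1 ?addr0 // => i ne_i.
have {}ne_i : (i : nat) != a.
  by apply: contraNneq ne_i => e; apply/eqP/val_inj; rewrite /= e inordK // ltnS leq_addr.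
case: (ltngtP i a) ne_i => // h _; last by rewrite [p`__]nth_default ?mul0r // (leq_trans sp).
by rewrite [q`__]nth_default ?mulr0 // (leq_trans sq) //; have := ltn_ord i; lia.
Qed.

Lemma size_prod_le (R : nzSemiRingType) (I : Type) (r : seq I) (f : I -> {poly R}) a :
    (forall i, (size (f i) <= (a i).+1)%N) ->
  (size (\prod_(i <- r) f i)%R <= (\sum_(i <- r) a i).+1)%N.
Proof.
move=> sf; elim: r => [|i r IHr]; first by rewrite !big_nil size_poly1.
by rewrite !big_cons; apply: leq_trans (size_polyMleq _ _) _; have := sf i; lia.
Qed.

Lemma coef_prod_top (R : comNzRingType) (I : Type) (r : seq I) (f : I -> {poly R}) a :
    (forall i, (size (f i) <= (a i).+1)%N) ->
  (\prod_(i <- r) f i)`_(\sum_(i <- r) a i) = \prod_(i <- r) (f i)`_(a i).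
Proof.
move=> sf; elim: r => [|i r IHr]; first by rewrite !big_nil coef1.
by rewrite !big_cons coefM_top ?IHr // size_prod_le.
Qed.

(** A permutation only reorders the second summands, so all terms of the Leibniz expansion share the
    degree bound [\sum_i (k i + k i)], and their coefficients there assemble into a determinant. *)
Lemma coef_det_top (R : comNzRingType) n (A : 'M[{poly R}]_n) (k : 'I_n -> nat) :
    (forall i j, size (A i j) <= (k i + k j).+1)%N ->
  (\det A)`_(\sum_i (k i + k i)) = \det (\matrix_(i, j) (A i j)`_(k i + k j)).
Proof.
move=> sA; rewrite /determinant coef_sum; apply: eq_bigr => s _.
have -> : (\sum_i (k i + k i) = \sum_i (k i + k (s i)))%N.
  by rewrite !big_split /= [X in (_ + X)%N](reindex_inj (@perm_inj _ s)).
rewrite -signr_odd -[in RHS]signr_odd.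
case: (odd s); rewrite ?mulN1r ?mul1r ?coefN coef_prod_top //.
  by congr (- _); apply: eq_bigr => i _; rewrite mxE.
by apply: eq_bigr => i _; rewrite mxE.
Qed.

Section ConjPoly.
Variable C : numClosedFieldType.
Implicit Types p q : {poly C}.

Lemma pconjK : involutive (pconj : {poly C} -> {poly C}).
Proof. by move=> p; apply/polyP=> i; rewrite !coef_map /= conjCK. Qed.

Lemma size_pconj p : size (pconj p) = size p.
Proof. exact: size_map_poly. Qed.

Lemma pconj_eq0 p : (pconj p == 0) = (p == 0).
Proof. exact: map_poly_eq0. Qed.

Lemma horner_pconj p x : (pconj p).[x^*] = (p.[x])^*.
Proof. exact: horner_map. Qed.

Lemma pconj_XsubC (a : C) : pconj ('X - a%:P) = 'X - (a^*)%:P.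
Proof. by rewrite rmorphB /= map_polyX map_polyC. Qed.

Lemma ctK m n (A : 'M[{poly C}]_(m, n)) : A ^t~ ^t~ = A.
Proof. by apply/matrixP=> i j; rewrite !mxE pconjK. Qed.

Lemma ct_mul m n k (A : 'M[{poly C}]_(m, n)) (B : 'M_(n, k)) :
  (A *m B) ^t~ = B ^t~ *m A ^t~.
Proof. by rewrite trmx_mul map_mxM. Qed.

Lemma ctZ m n c (A : 'M[{poly C}]_(m, n)) : (c *: A) ^t~ = pconj c *: A ^t~.
Proof. by rewrite linearZ map_mxZ. Qed.

Lemma ct_scalar n (c : {poly C}) : (c%:M : 'M_n) ^t~ = (pconj c)%:M.
Proof. by rewrite tr_scalar_mx map_scalar_mx. Qed.

Lemma det_ct n (A : 'M[{poly C}]_n) : \det (A ^t~) = pconj (\det A).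
Proof. by rewrite det_map_mx det_tr. Qed.

Lemma sqr_norm_sum_eq0 (I : finType) (f : I -> C) :
  \sum_k f k * (f k)^* = 0 -> forall k, f k = 0.
Proof.
move=> f0 k; apply/eqP; rewrite -normr_eq0 -sqrf_eq0 normCK.
have h (i : I) : true -> 0 <= f i * (f i)^* by move=> _; exact: mul_conjC_ge0.
by rewrite (psumr_eq0P h f0 (i := k)).
Qed.

(* The leading coefficient of [p * pconj p] is a squared norm, so these do not cancel in a sum. *)
Lemma size_sum_sqr_norm (I : finType) (f : I -> {poly C}) m :
    (forall k, size (f k) <= m)%N -> (exists k, size (f k) = m) -> (0 < m)%N ->
  size (\sum_k f k * pconj (f k)) = (m + m).-1.
Proof.
move=> le_f [k fk]; case: m le_f fk => // m le_f fk _.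
rewrite addSn addnS /=.
apply/eqP; rewrite eqn_leq; apply/andP; split.
  apply: leq_trans (size_sum _ _ _) _; apply/bigmax_leqP=> i _.
  apply: leq_trans (size_polyMleq _ _) _; rewrite size_pconj.
  by have := le_f i; lia.
rewrite ltnNge; apply/negP => /leq_sizeP /(_ _ (leqnn _)).
rewrite coef_sum => h.
have /(_ k) : forall k, (f k)`_m = 0.
  apply: sqr_norm_sum_eq0; rewrite -[RHS]h; apply: eq_bigr => i _.
  by rewrite coefM_top ?size_pconj // coef_map.
move=> /eqP; rewrite -[m]/(m.+1.-1) -fk; have := lead_coef_eq0 (f k).
by rewrite /lead_coef => ->; rewrite -size_poly_eq0 fk.
Qed.

(** In degrees: twice the degree of any nonzero [f k] is at most the degree of the sum. This is what
    later bounds the entries of the projection and of [M]. *)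
Lemma size_sum_sqr_norm_ge (I : finType) (f : I -> {poly C}) k :
  (size (f k) + size (f k) <= (size (\sum_k f k * pconj (f k))%R).+1)%N.
Proof.
pose m := (\max_k size (f k))%N.
have le_m i : (size (f i) <= m)%N by exact: (leq_bigmax (F := fun i => size (f i))).
have [i fi] := @bigop.eq_bigmax _ (fun i => size (f i)) (ltac:(by apply/card_gt0P; exists k)).
have [m0|m0] := posnP m; first by have := le_m k; rewrite m0 leqn0 => /eqP->.
by rewrite (size_sum_sqr_norm le_m (ex_intro _ i (esym fi)) m0); have := le_m k; lia.
Qed.

Lemma sum_sqr_norm_eq0 (I : finType) (f : I -> {poly C}) :
  \sum_k f k * pconj (f k) = 0 -> forall k, f k = 0.
Proof.
move=> f0 k; apply/eqP; rewrite -size_poly_eq0.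
by have := size_sum_sqr_norm_ge f k; rewrite f0 size_poly0; lia.
Qed.

(* A factor ['X - a%:P] of [d] divides every [f k] and cancels; once [d] does not vanish
   at [a], the vanishing of every [f k] gives the double root. *)
Lemma sqr_norm_real_root (I : finType) (f : I -> {poly C}) d h a :
    d != 0 -> d * pconj d * h = \sum_k f k * pconj (f k) ->
    a^* = a -> root h a -> ('X - a%:P) * ('X - a%:P) %| h.
Proof.
move=> + + areal ha; have [s] := ubnP (size d).
elim: s d f => // s IHs d f lt_s d0 dh.
have f_div k : 'X - a%:P %| f k.
  rewrite dvdp_XsubCl; apply/rootP; move: k; apply: sqr_norm_sum_eq0.
  have /(congr1 (fun p => p.[a])) := dh.
  rewrite hornerM (rootP ha) mulr0 horner_sum => e; rewrite [RHS]e.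
  by apply: eq_bigr => k _; rewrite hornerM -{4}areal horner_pconj.
have pX : pconj ('X - a%:P) = 'X - a%:P by rewrite pconj_XsubC areal.
have Xn0 : 'X - a%:P != 0 by rewrite polyXsubC_eq0.
pose g k := f k %/ ('X - a%:P).
have fE k : f k = g k * ('X - a%:P) by rewrite divpK.
have dh' : d * pconj d * h = (\sum_k g k * pconj (g k)) * (('X - a%:P) * ('X - a%:P)).
  rewrite dh mulr_suml; apply: eq_bigr => k _.
  by rewrite fE rmorphM /= pX mulrACA.
have [ra | nra] := boolP (root d a).
  have /factor_theorem [e dE] := ra.
  apply: (IHs e g).
  - move: lt_s; rewrite dE size_Mmonic ?monicXsubC ?size_XsubC ?addn2 //.
    by apply: contraNneq d0 => e0; rewrite dE e0 mul0r.
  - by apply: contraNneq d0 => e0; rewrite dE e0 mul0r.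
  apply: (mulIf (mulf_neq0 Xn0 Xn0)); rewrite -dh' dE rmorphM /= pX.
  ring.
have cop : coprimep (('X - a%:P) * ('X - a%:P)) (d * pconj d).
  have nc : ~~ root (pconj d) a by rewrite /root -areal horner_pconj conjC_eq0.
  by rewrite coprimepMl andbb coprimep_sym coprimep_XsubC rootM negb_or nra nc.
by rewrite -(Gauss_dvdpr _ cop) dh' dvdp_mull.
Qed.

End ConjPoly.

(** * Self-adjoint polynomial matrices with a commuting projection *)

Section Cancel.
Variable R : idomainType.

Lemma scalemx_inj m n (c : R) (A B : 'M_(m, n)) : c != 0 -> c *: A = c *: B -> A = B.
Proof.
move=> c0 /matrixP e; apply/matrixP=> i j; have := e i j; rewrite !mxE.
exact: mulfI.
Qed.

Lemma mulmx_Icancel m n (E : 'M[R]_m) (A B : 'M_(m, n)) :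
  \det E != 0 -> E *m A = E *m B -> A = B.
Proof.
move=> dE /(congr1 (mulmx (\adj E))); rewrite !mulmxA !mul_adj_mx !mul_scalar_mx.
exact: scalemx_inj.
Qed.

Lemma mulmx_cancelI m n (E : 'M[R]_n) (A B : 'M_(m, n)) :
  \det E != 0 -> A *m E = B *m E -> A = B.
Proof.
move=> dE /(congr1 (mulmx^~ (\adj E))); rewrite -!mulmxA !mul_mx_adj !mul_mx_scalar.
exact: scalemx_inj.
Qed.

Lemma char_poly_conj n (E M M' : 'M[R]_n) :
  \det E != 0 -> E *m M' = M *m E -> char_poly M' = char_poly M.
Proof.
move=> dE EM; have dE' : \det (map_mx polyC E) != 0 by rewrite det_map_mx polyC_eq0.
apply: (mulIf dE'); rewrite /char_poly mulrC -!det_mulmx; congr (\det _).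
rewrite /char_poly_mx mulmxBr mulmxBl -!map_mxM EM; congr (_ - _).
by rewrite mul_mx_scalar mul_scalar_mx.
Qed.

Lemma mxtrace_sqr_conj n (E M M' : 'M[R]_n) :
  \det E != 0 -> E *m M' = M *m E -> \tr (M' *m M') = \tr (M *m M).
Proof.
move=> dE EM; apply: (mulfI dE).
rewrite -!mxtraceZ -!mul_scalar_mx -{1}mul_adj_mx -mulmxA mxtrace_mulC (mulmxA E) EM.
by rewrite -(mulmxA M E) EM -!mulmxA mul_mx_adj mul_mx_scalar -scalemxAr mul_scalar_mx.
Qed.

End Cancel.

Section State.
Variables (C : numClosedFieldType) (n : nat).
Implicit Types (H J M N E : 'M[{poly C}]_n) (c : {poly C}).

(** Over the rational functions this is [H = Z Z^H] with [Z = Y / d], and it stands for positive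
    semidefiniteness. The denominator keeps the notion stable under changes of basis that are
    invertible over [C(x)] only. *)
Definition sq_form H :=
  exists (d : {poly C}) (Y : 'M_n), d != 0 /\ (d * pconj d) *: H = Y *m Y ^t~.

Lemma sq_form_ct H : sq_form H -> H ^t~ = H.
Proof.
move=> [d [Y [d0 e]]]; have dd : d * pconj d != 0 by rewrite mulf_neq0 ?pconj_eq0.
apply: (scalemx_inj dd); rewrite e.
have -> : d * pconj d = pconj (d * pconj d) by rewrite rmorphM /= pconjK mulrC.
by rewrite -ctZ e ct_mul ctK.
Qed.

(** [\adj E *m Y] is [E^-1 Y] multiplied by [\det E], and this factor joins the denominator [d]. *)
Lemma sq_form_conj H H' E : \det E != 0 -> H = E *m H' *m E ^t~ ->
  sq_form H -> sq_form H'.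
Proof.
move=> dE -> [d [Y [d0 e]]]; exists (d * \det E), (\adj E *m Y); split.
  by rewrite mulf_neq0.
rewrite ct_mul mulmxA -(mulmxA (\adj E)) -e -!scalemxAr -!scalemxAl rmorphM /=.
rewrite !mulmxA mul_adj_mx mul_scalar_mx -!scalemxAl -mulmxA -ct_mul mul_adj_mx.
by rewrite ct_scalar mul_mx_scalar !scalerA mulrACA !mulrA.
Qed.

(* [N] represents the rational idempotent [N / c], and [J] the form it induces from [H]. *)
Record reducing_form (chi : {poly {poly C}}) (tau : {poly C}) H J M N c : Prop := {
  rf_sq : sq_form H;
  rf_det : \det H != 0;
  rf_J : J ^t~ = J;
  rf_sa : M *m H = H *m M ^t~;
  rf_comm : N *m M = M *m N;
  rf_NN : N *m N = c *: N;
  rf_NH : N *m H = c *: J;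
  rf_c : c != 0;
  rf_N0 : N != 0;
  rf_N1 : N != c%:M;
  rf_chi : char_poly M = chi;
  rf_tau : \tr (M *m M) = tau }.

Variables (chi : {poly {poly C}}) (tau : {poly C}).
Local Notation good := (reducing_form chi tau).

(** A change of basis by [E], invertible over [C(x)]: operators become [E^-1 M E] and forms
    [E^-1 H E^-H]. Equations without inverses cover shears, divisions by a diagonal matrix and
    constant changes of basis at once. *)
Lemma reducing_form_conj H J M N c H' J' M' N' E :
    \det E != 0 -> E *m M' = M *m E -> E *m N' = N *m E ->
    H = E *m H' *m E ^t~ -> J = E *m J' *m E ^t~ ->
  good H J M N c -> good H' J' M' N' c.
Proof.
move=> dE EM EN HE JE [sq det Jct sa comm NN NH c0 N0 N1 gchi gtau].
have dE' : \det (E ^t~) != 0 by rewrite det_ct pconj_eq0.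
have cE A B : E *m A *m E ^t~ = E *m B *m E ^t~ -> A = B.
  by move=> e; apply: (mulmx_Icancel dE); apply: (mulmx_cancelI dE').
split.
- exact: sq_form_conj HE sq.
- by apply: contraNneq det => e; rewrite HE !det_mulmx e mulr0 mul0r.
- by apply: cE; rewrite -JE -[RHS]Jct [in RHS]JE !ct_mul ctK mulmxA.
- apply: cE; transitivity (M *m H); first by rewrite [in RHS]HE !mulmxA EM.
  by rewrite sa [in LHS]HE -!mulmxA -!ct_mul EM.
- by apply: (mulmx_Icancel dE); rewrite !mulmxA EN EM -!mulmxA EM EN !mulmxA comm.
- by apply: (mulmx_Icancel dE); rewrite mulmxA EN -mulmxA EN mulmxA NN -scalemxAr EN scalemxAl.
- apply: cE; transitivity (N *m H); first by rewrite [in RHS]HE !mulmxA EN.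
  by rewrite NH [in LHS]JE -scalemxAr -scalemxAl.
- exact: c0.
- by apply: contraNneq N0 => e; apply/eqP/(mulmx_cancelI dE); rewrite -EN e mulmx0 mul0mx.
- apply: contraNneq N1 => e; apply/eqP/(mulmx_cancelI dE).
  by rewrite -EN e mul_mx_scalar mul_scalar_mx.
- by rewrite -gchi; apply: char_poly_conj EM.
- by rewrite -gtau; apply: mxtrace_sqr_conj EM.
Qed.

Lemma rf_NJ H J M N c : good H J M N c -> N *m J = c *: J.
Proof.
move=> g; apply: (scalemx_inj (rf_c g)).
by rewrite scalemxAr -(rf_NH g) mulmxA (rf_NN g) -scalemxAl.
Qed.

Lemma rf_HN H J M N c : good H J M N c -> H *m N ^t~ = pconj c *: J.
Proof.
move=> g; have := congr1 (fun X => X ^t~) (rf_NH g).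
by rewrite ct_mul ctZ (rf_J g) (sq_form_ct (rf_sq g)).
Qed.

(** [J] is [P H P^H] for the projection [P = N / c], so [P] times a factor of [H] is a factor of
    [J]. *)
Lemma rf_sqJ H J M N c : good H J M N c -> sq_form J.
Proof.
move=> g; have [d [Y [d0 e]]] := rf_sq g.
exists (d * c), (N *m Y); split; first by rewrite mulf_neq0 ?(rf_c g).
rewrite ct_mul mulmxA -(mulmxA N) -e -scalemxAr -scalemxAl -mulmxA (rf_HN g).
by rewrite -scalemxAr (rf_NJ g) !scalerA rmorphM /= mulrACA -!mulrA (mulrC c).
Qed.

Definition shear (i : 'I_n) (u : 'rV[{poly C}]_n) : 'M_n := 1%:M + delta_mx i 0 *m u.

Lemma shearK i (u : 'rV_n) : u 0 i = 0 -> shear i u *m shear i (- u) = 1%:M.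
Proof.
move=> ui; rewrite /shear mulmxDl mul1mx mulmxDr mulmx1 -mulmxA.
have -> : u *m (delta_mx i 0 *m - u) = 0.
  by rewrite mulmxA -colE [col i u]mx11_scalar !mxE ui mul_scalar_mx scale0r.
by rewrite mulmx0 addr0 mulmxN -addrA addNr addr0.
Qed.

Lemma reducing_form_shear H J M N c i (u : 'rV_n) : u 0 i = 0 -> good H J M N c ->
  let S := shear i u in let S' := shear i (- u) in
  good (S *m H *m S ^t~) (S *m J *m S ^t~) (S *m M *m S') (S *m N *m S') c.
Proof.
move=> ui g S S'.
have SS' : S *m S' = 1%:M by rewrite shearK.
have S'S : S' *m S = 1%:M by rewrite /S' /S -{2}[u]opprK shearK // mxE ui oppr0.
have dS : \det S' != 0.
  apply/eqP=> e; have /eqP := congr1 determinant SS'.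
  by rewrite det_mulmx e mulr0 det1 eq_sym oner_eq0.
have SSt : S ^t~ *m S' ^t~ = 1%:M by rewrite -ct_mul S'S ct_scalar rmorph1.
apply: (reducing_form_conj (E := S')) g => //; rewrite ?mulmxA ?S'S ?mul1mx //;
  by rewrite -!mulmxA SSt !mulmx1.
Qed.

Lemma size_det_shear i (u : 'rV_n) H : u 0 i = 0 ->
  size (\det (shear i u *m H *m (shear i u) ^t~)) = size (\det H).
Proof.
move=> ui; rewrite !det_mulmx det_ct.
have : \det (shear i u) \is a GRing.unit.
  by apply/unitrP; exists (\det (shear i (- u))); rewrite mulrC -det_mulmx shearK // det1.
rewrite poly_unitE => /andP[/size_poly1P[a a0 ->] _].
rewrite map_polyC mulrAC -rmorphM mul_polyC size_scale //.
by rewrite mulf_neq0 ?conjC_eq0.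
Qed.

(** Dividing the [i]-th basis vector by [e i] enlarges the lattice. The divisibilities say that
    forms and operators remain polynomial in the new basis. *)
Lemma reducing_form_divide H J M N c (e : 'I_n -> {poly C}) :
    (forall i, e i != 0) ->
    (forall i j, e i * pconj (e j) %| H i j) ->
    (forall i j, e i * pconj (e j) %| J i j) ->
    (forall i j, e i %| M i j * e j) -> (forall i j, e i %| N i j * e j) ->
  good H J M N c ->
  exists H' J' M' N', good H' J' M' N' c /\
    \det H = (\prod_i (e i * pconj (e i))) * \det H'.
Proof.
move=> e0 eH eJ eM eN g.
pose D := diag_mx (\row_i e i).
have De i j : D i j = e i *+ (i == j) by rewrite !mxE.
have DA A i j : (D *m A) i j = e i * A i j by rewrite mul_diag_mx !mxE.
have AD A i j : (A *m D) i j = A i j * e j by rewrite mul_mx_diag !mxE.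
have Dct : D ^t~ = diag_mx (\row_i pconj (e i)).
  by apply/matrixP=> i j; rewrite !mxE rmorphMn /= eq_sym; case: eqP => // ->.
have ADt A i j : (A *m D ^t~) i j = A i j * pconj (e j) by rewrite Dct mul_mx_diag !mxE.
have HE : H = D *m (\matrix_(i, j) (H i j %/ (e i * pconj (e j)))) *m D ^t~.
  by apply/matrixP=> i j; rewrite ADt DA mxE mulrAC -[LHS](divpK (eH i j)) mulrC.
have JE : J = D *m (\matrix_(i, j) (J i j %/ (e i * pconj (e j)))) *m D ^t~.
  by apply/matrixP=> i j; rewrite ADt DA mxE mulrAC -[LHS](divpK (eJ i j)) mulrC.
have ME : D *m (\matrix_(i, j) ((M i j * e j) %/ e i)) = M *m D.
  by apply/matrixP=> i j; rewrite DA AD mxE mulrC divpK.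
have NE : D *m (\matrix_(i, j) ((N i j * e j) %/ e i)) = N *m D.
  by apply/matrixP=> i j; rewrite DA AD mxE mulrC divpK.
have dD : \det D != 0 by rewrite det_diag; apply/prodf_neq0=> i _; rewrite mxE.
exists (\matrix_(i, j) (H i j %/ (e i * pconj (e j)))),
  (\matrix_(i, j) (J i j %/ (e i * pconj (e j)))),
  (\matrix_(i, j) ((M i j * e j) %/ e i)), (\matrix_(i, j) ((N i j * e j) %/ e i)).
split; first exact: (reducing_form_conj dD ME NE HE JE).
rewrite {1}HE !det_mulmx mulrAC Dct !det_diag -big_split /=; congr (_ * _).
by apply: eq_bigr => i _; rewrite !mxE.
Qed.

End State.

Lemma common_eigenvector_in (C : numClosedFieldType) n (S A B : 'M[C]_n) :
    S != 0 -> stablemx S A -> stablemx S B -> comm_mx A B ->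
  exists v : 'rV_n, [/\ v != 0, (v <= S)%MS,
    exists a, v *m A = a *: v & exists b, v *m B = b *: v].
Proof.
move=> S0 SA SB AB.
have [||v v0 /andP[vA vB]] := @common_eigenvector2 C (\rank S) (restrictmx S A) (restrictmx S B).
- by rewrite lt0n mxrank_eq0.
- by rewrite -!conjmxM ?inE ?stablemx_row_base // AB.
exists (v *m row_base S); split.
- by rewrite mulmx_free_eq0 ?row_base_free.
- by rewrite mulmx_sub // eq_row_base.
- by move: vA; rewrite stablemx_restrict // => /eigenvectorP[a /eigenspaceP]; exists a.
- by move: vB; rewrite stablemx_restrict // => /eigenvectorP[a /eigenspaceP]; exists a.
Qed.

(** * Enlarging the lattice by one eigenvector *)

Section Step.
Variables (C : numClosedFieldType) (n : nat).
Variables (chi : {poly {poly C}}) (tau : {poly C}).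
Implicit Types (H J M N E : 'M[{poly C}]_n) (c : {poly C}).
Local Notation good := (reducing_form chi tau).
Local Notation "A @@ a" := (map_mx (horner_eval a) A) (at level 30).

(** For real [a] the two factors coincide and the double root comes from [sqr_norm_real_root].
    Otherwise they are coprime, and [a^*] is a root because [H i i] is its own conjugate. *)
Lemma sq_form_diag_dvd H i a : sq_form H -> root (H i i) a ->
  ('X - a%:P) * ('X - (a^*)%:P) %| H i i.
Proof.
move=> sH ra; have Hc := sq_form_ct sH.
have [ar|an] := eqVneq (a^*) a.
  have [d [Y [d0 e]]] := sH; rewrite ar.
  apply: (sqr_norm_real_root (f := Y i) d0 _ ar ra).
  have := congr1 (fun X : 'M_n => X i i) e; rewrite !mxE => ->.
  by apply: eq_bigr => k _; rewrite !mxE.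
have cop : coprimep ('X - a%:P) ('X - (a^*)%:P) by rewrite coprimep_XsubC2 // subr_eq0.
rewrite (Gauss_dvdp _ cop) dvdp_XsubCl ra /=.
by rewrite dvdp_XsubCl -{1}Hc !mxE /root horner_pconj (rootP ra) conjC0.
Qed.

Lemma reducing_form_extract H J M N c a (S : 'M[C]_n) : good H J M N c ->
    S != 0 -> S *m (H @@ a) = 0 -> S *m (J @@ a) = 0 ->
    stablemx S (M @@ a) -> stablemx S (N @@ a) ->
  exists H' J' M' N', good H' J' M' N' c /\ (size (\det H') < size (\det H))%N.
Proof.
move=> g S0 SH SJ SM SN.
have cMN : comm_mx (M @@ a) (N @@ a).
  by rewrite /comm_mx -!map_mxM (rf_comm g).
have [v0 [v0n0 /submxP[w vS] [l vM] [m vN]]] := common_eigenvector_in S0 SM SN cMN.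
have [i vi0] : exists i, v0 0 i != 0 by apply/rV0Pn.
pose v := (v0 0 i)^-1 *: v0.
have vi : v 0 i = 1 by rewrite mxE mulVf.
have vH : v *m (H @@ a) = 0 by rewrite -scalemxAl vS -mulmxA SH mulmx0 scaler0.
have vJ : v *m (J @@ a) = 0 by rewrite -scalemxAl vS -mulmxA SJ mulmx0 scaler0.
have {}vM : v *m (M @@ a) = l *: v by rewrite -scalemxAl vM !scalerA mulrC.
have {}vN : v *m (N @@ a) = m *: v by rewrite -scalemxAl vN !scalerA mulrC.
clearbody v.
(* The shear by [v - e_i] makes [v] the [i]-th basis vector; it is invertible because [v] has been
   scaled to have [i]-th coordinate 1. *)
pose u : 'rV[{poly C}]_n := map_mx polyC (v - delta_mx 0 i).
have ui : u 0 i = 0 by rewrite !mxE vi !eqxx subrr polyC0.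
pose T := shear i u; pose T' := shear i (- u).
have g1 := reducing_form_shear ui g; rewrite -/T -/T' in g1.
have rowT : row i (T @@ a) = v.
  apply/rowP=> j; rewrite !mxE big_ord1 !mxE !eqxx /= /horner_eval mul1r hornerD hornerC eq_sym.
  by rewrite -polyC_natr hornerC subrKC.
have row1 A : v *m (A @@ a) = 0 -> forall j, root ((T *m A *m T ^t~) i j) a.
  move=> vA j; rewrite /root.
  have /rowP/(_ j) : row i ((T *m A *m T ^t~) @@ a) = 0.
    by rewrite !map_mxM !row_mul rowT vA mul0mx.
  by rewrite [RHS]mxE [LHS]mxE [LHS]mxE /horner_eval => ->.
have row2 A k : v *m (A @@ a) = k *: v -> forall j, j != i -> root ((T *m A *m T') i j) a.
  move=> vA j ji; rewrite /root.
  have /rowP/(_ j) : row i ((T *m A *m T') @@ a) = k *: delta_mx 0 i.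
    rewrite !map_mxM !row_mul rowT vA -scalemxAl -rowT -row_mul -map_mxM shearK //.
    by rewrite map_mx1 matrix.row1.
  rewrite [LHS]mxE [LHS]mxE /horner_eval => ->.
  by rewrite !mxE (negPf ji) andbF mulr0.
pose e j : {poly C} := if j == i then 'X - a%:P else 1.
have ei : e i = 'X - a%:P by rewrite /e eqxx.
have ej j : j != i -> e j = 1 by rewrite /e => /negPf->.
have e0 j : e j != 0 by rewrite /e; case: ifP => _; rewrite ?polyXsubC_eq0 ?oner_eq0.
have formdvd A : sq_form A -> (forall j, root (A i j) a) ->
    forall j k, e j * pconj (e k) %| A j k.
  move=> sA rA j k; have Ac := sq_form_ct sA.
  have [->|ji] := eqVneq j i; last first.
    rewrite (ej j ji) mul1r; have [->|ki] := eqVneq k i; last by rewrite ej // rmorph1 dvd1p.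
    rewrite ei pconj_XsubC dvdp_XsubCl -Ac !mxE /root horner_pconj.
    by rewrite (rootP (rA j)) conjC0.
  have [->|ki] := eqVneq k i; last by rewrite (ej k ki) rmorph1 mulr1 ei dvdp_XsubCl.
  by rewrite ei pconj_XsubC; apply: sq_form_diag_dvd.
have opdvd A : (forall j, j != i -> root (A i j) a) -> forall j k, e j %| A j k * e k.
  move=> rA j k; have [->|ji] := eqVneq j i; last by rewrite (ej j ji) dvd1p.
  have [->|ki] := eqVneq k i; first by rewrite dvdp_mull.
  by rewrite dvdp_mulr // ei dvdp_XsubCl rA.
have [||||H' [J' [M' [N' [g' dH]]]]] := reducing_form_divide e0 _ _ _ _ g1.
- by apply: formdvd; [exact: rf_sq g1 | exact: row1].
- by apply: formdvd; [exact: rf_sqJ g1 | exact: row1].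
- by apply: opdvd; exact: row2 vM.
- by apply: opdvd; exact: row2 vN.
exists H', J', M', N'; split=> //.
have Xn0 b : 'X - b%:P != 0 :> {poly C} by rewrite polyXsubC_eq0.
rewrite -(size_det_shear H ui) -/T dH (bigD1 i) //= big1 => [|j ji].
  rewrite mulr1 ei pconj_XsubC !size_mul ?mulf_neq0 ?(rf_det g') // !size_XsubC.
  by rewrite addSn.
by rewrite ej // rmorph1 mulr1.
Qed.

End Step.

(** * Reduction to the standard form *)

Section Reduction.
Variables (C : numClosedFieldType) (n : nat).
Variables (chi : {poly {poly C}}) (tau : {poly C}).
Implicit Types (H J M N E : 'M[{poly C}]_n) (c : {poly C}).
Local Notation good := (reducing_form chi tau).
Local Notation "A @@ a" := (map_mx (horner_eval a) A) (at level 30).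

(** Induction on [size (\det H) + size c]. At a root [a] of [c], either [N(a) = 0] and [x - a]
    cancels between [N] and [c], or the row space of [N(a)] is killed by both forms and an
    eigenvector is extracted from it. When [c] is constant, the kernel of [H(a)] at a root [a] of
    [\det H] plays the same role. *)
Lemma reducing_form_saturate H J M N c : good H J M N c ->
  exists H' J' M' N' c', [/\ good H' J' M' N' c', size (\det H') = 1%N & size c' = 1%N].
Proof.
have [s] := ubnP (size (\det H) + size c).
elim: s H J M N c => // s IHs H J M N c lt_s g.
have c0 := rf_c g; have H0 := rf_det g.
have [sc|sc] := eqVneq (size c) 1%N; last first.
  have /closed_rootP[a ra] := sc.
  have eva A : (c *: A) @@ a = 0.
    by apply/matrixP=> i j; rewrite !mxE /horner_eval hornerM (rootP ra) mul0r.
  have [Na0|Na0] := eqVneq (N @@ a) 0.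
    have /factor_theorem[c1 cE] := ra.
    have X0 : 'X - a%:P != 0 :> {poly C} by rewrite polyXsubC_eq0.
    have NE : exists N1, N = ('X - a%:P) *: N1.
      exists (\matrix_(i, j) (N i j %/ ('X - a%:P))); apply/matrixP=> i j.
      rewrite !mxE mulrC divpK // dvdp_XsubCl /root.
      by move/matrixP/(_ i j)/eqP: Na0; rewrite !mxE.
    have [N1 {}NE] := NE.
    have c10 : c1 != 0 by apply: contraNneq c0 => e; rewrite cE e mul0r.
    apply: (IHs H J M N1 c1).
      have sc1 : size c = (size c1).+1.
        by rewrite cE size_mul // (size_XsubC a : _ = 2%N) addn2.
      by move: lt_s; rewrite sc1 addnS ltnS.
    case: g => sq det Jct sa comm NN NH _ N0 N1' gchi gtau.
    split=> //; try (apply: (scalemx_inj X0)).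
    - by rewrite scalemxAl scalemxAr -NE.
    - apply: (scalemx_inj X0); transitivity (N *m N).
        by rewrite NE -scalemxAl -scalemxAr.
      by rewrite NN NE cE !scalerA; congr (_ *: _); ring.
    - by rewrite scalemxAl -NE NH cE scalerA mulrC.
    - by apply: contraNneq N0 => e; rewrite NE e scaler0.
    - apply: contraNneq N1' => e; rewrite NE e cE.
      by rewrite -mul_scalar_mx -scalar_mxM mulrC.
  have [|||||H' [J' [M' [N' [g' lt']]]]] := reducing_form_extract (a := a) (S := N @@ a) g.
  - by [].
  - by rewrite -map_mxM (rf_NH g) eva.
  - by rewrite -map_mxM (rf_NJ g) eva.
  - by rewrite -map_mxM (rf_comm g) map_mxM submxMl.
  - exact: submxMl.
  apply: IHs g'; lia.
have [sH|sH] := eqVneq (size (\det H)) 1%N; first by exists H, J, M, N, c.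
have /closed_rootP[a ra] := sH.
have ca : c.[a] != 0 /\ (pconj c).[a] != 0.
  by case/eqP/size_poly1P: sc => k k0 ->; rewrite map_polyC !hornerC conjC_eq0.
pose S := kermx (H @@ a).
have SH : S *m (H @@ a) = 0 by exact: mulmx_ker.
have evZ k A : (k *: A) @@ a = k.[a] *: (A @@ a).
  by apply/matrixP=> i j; rewrite !mxE /horner_eval hornerM.
(* The identity [H N^H = pconj c J] passes the kernel of [H(a)] on to [J(a)], as [pconj c] is a
   nonzero constant. *)
have SJ : S *m (J @@ a) = 0.
  apply: (scalemx_inj ca.2); rewrite scalemxAr -evZ -(rf_HN g) map_mxM mulmxA SH.
  by rewrite mul0mx scaler0.
have [|||||H' [J' [M' [N' [g' lt']]]]] := reducing_form_extract (a := a) (S := S) g.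
- rewrite kermx_eq0 row_free_unit unitmxE det_map_mx unitfE negbK.
  exact: ra.
- by [].
- by [].
- by apply/sub_kermxP; rewrite -mulmxA -map_mxM (rf_sa g) map_mxM mulmxA SH mul0mx.
- by apply/sub_kermxP; rewrite -mulmxA -map_mxM (rf_NH g) evZ -scalemxAr SJ scaler0.
apply: IHs g'; lia.
Qed.

(** With [m i] the largest size in row [i] of [Y], the witness is [k i = m i - size d]. Leading
    terms cannot cancel on the diagonal, whence an equality there; off the diagonal they may. *)
Lemma sq_form_sizes H : sq_form H -> \det H != 0 ->
  exists k : 'I_n -> nat, (forall i, size (H i i) = (k i + k i).+1) /\
    forall i j, (size (H i j) <= (k i + k j).+1)%N.
Proof.
move=> [d [Y [d0 e]]] dH.
have dd0 : d * pconj d != 0 by rewrite mulf_neq0 ?pconj_eq0.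
have eij i j : d * pconj d * H i j = \sum_k Y i k * pconj (Y j k).
  have := congr1 (fun X : 'M_n => X i j) e; rewrite !mxE => ->.
  by apply: eq_bigr => k _; rewrite !mxE.
pose m i := (\max_k size (Y i k))%N.
have le_m i k : (size (Y i k) <= m i)%N by exact: (leq_bigmax (F := fun k => size (Y i k))).
(* A zero row of [Y] would give a zero row of [H]. *)
have m0 i : (0 < m i)%N.
  rewrite lt0n; apply: contraNneq dH => mi; rewrite (expand_det_row H i) big1 // => j _.
  apply/eqP; rewrite mulf_eq0; apply/orP; left.
  rewrite -(mulrI_eq0 _ (mulfI dd0)) eij big1 // => k _.
  by have := le_m i k; rewrite mi leqn0 size_poly_eq0 => /eqP->; rewrite mul0r.
have sz i : size (d * pconj d * H i i) = (m i + m i).-1.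
  rewrite eij (size_sum_sqr_norm (m := m i)) //.
  have [|k mk] := @bigop.eq_bigmax _ (fun k => size (Y i k)) _; last by exists k.
  by apply/card_gt0P; exists i.
have H0 i : H i i != 0.
  by apply/eqP=> h; have := sz i; rewrite h mulr0 size_poly0; have := m0 i; lia.
have sd : (0 < size d)%N by rewrite size_poly_gt0.
have szM p : p != 0 -> (size (d * pconj d * p)%R = ((size d + size d).-1 + size p).-1)%N.
  by move=> p0; rewrite !size_mul ?pconj_eq0 // size_pconj.
have sp0 (p : {poly C}) : p != 0 -> (0 < size p)%N by rewrite size_poly_gt0.
have sH i : (size (H i i) + (size d + size d) = m i + m i + 1)%N.
  by have := sz i; rewrite szM //; have := sp0 _ (H0 i); have := m0 i; lia.
exists (fun i => m i - size d)%N; split=> [i|i j].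
  by have := sH i; have := sp0 _ (H0 i); lia.
have [->|Hij] := eqVneq (H i j) 0; first by rewrite size_poly0.
have : (size (d * pconj d * H i j)%R <= (m i + m j).-1)%N.
  rewrite eij; apply: leq_trans (size_sum _ _ _) _; apply/bigmax_leqP=> k _.
  apply: leq_trans (size_polyMleq _ _) _; rewrite size_pconj.
  by have := le_m i k; have := le_m j k; lia.
rewrite szM //; have := sp0 _ Hij; have := sp0 _ (H0 i); have := sp0 _ (H0 j).
by have := sH i; have := sH j; lia.
Qed.

End Reduction.

Lemma exists_nat_nonroot (C : numClosedFieldType) (p : {poly C}) :
  p != 0 -> exists m : nat, p.[m%:R] != 0.
Proof.
move=> p0; pose s : seq C := [seq m%:R | m <- iota 0 (size p)].
have [/allP rs|] := boolP (all (root p) s).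
  have us : uniq s by rewrite map_inj_uniq ?iota_uniq //; exact: mulrIn (oner_neq0 _).
  have := max_poly_roots p0 (introT allP rs) us.
  by rewrite size_map size_iota ltnn.
by case/allPn=> _ /mapP[m _ ->]; exists m.
Qed.

(** * From a unimodular form to a constant one *)

Section Normalisation.
Variables (C : numClosedFieldType) (n : nat).
Variables (chi : {poly {poly C}}) (tau : {poly C}).
Implicit Types (H J M N E : 'M[{poly C}]_n) (c : {poly C}).
Local Notation good := (reducing_form chi tau).

Lemma poly_mx_const H : (forall i j, (size (H i j) <= 1)%N) ->
  H = map_mx (@polyC C) (map_mx (coefp 0) H).
Proof.
by move=> sH; apply/matrixP=> i j; rewrite !mxE; apply: size1_polyC.
Qed.

Lemma conj_form_diag E H i :
  (E *m H *m E ^t~) i i = (row i E *m H *m (row i E) ^t~) 0 0.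
Proof.
rewrite -row_mul mxE [RHS]mxE; apply: eq_bigr => k _; rewrite !mxE.
by congr (_ * _); apply: eq_bigr.
Qed.

(** Induction on the sum of the diagonal sizes. The matrix [L] of top coefficients has as
    determinant the coefficient of [\det H] in degree [2 \sum_i k i], which is zero when some [k i]
    is positive, since [\det H] is constant. A kernel vector of [L] yields a shear that lowers one
    diagonal degree and keeps the other diagonal entries. *)
Lemma reducing_form_constant H J M N c : good H J M N c -> size (\det H) = 1%N ->
  exists (K : 'M[C]_n) J' M' N', good (map_mx (@polyC C) K) J' M' N' c.
Proof.
have [s] := ubnP (\sum_i size (H i i))%N.
elim: s H J M N => // s IHs H J M N lt_s g sH.
have [k [kd kH]] := sq_form_sizes (rf_sq g) (rf_det g).
have [/forallP k0|] := boolP [forall i, k i == 0%N].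
  exists (map_mx (coefp 0) H), J, M, N; rewrite -poly_mx_const // => i j.
  by have := kH i j; rewrite (eqP (k0 i)) (eqP (k0 j)).
rewrite negb_forall => /existsP[i0 ki0].
pose L := \matrix_(i, j) (H i j)`_(k i + k j).
have /eqP/det0P[w w0 wL] : \det L = 0.
  rewrite -coef_det_top // nth_default // sH (bigD1 i0) //=; lia.
have [i1 wi1] : exists i, w 0 i != 0 by apply/rV0Pn.
(* The index of largest degree in the support of [w]: this makes the exponents [k i - k j] below
   genuine differences. *)
pose i := [arg max_(i > i1 | w ord0 i != 0%R) k i]%N.
have [wi ki] : w 0 i != 0 /\ forall j, w 0 j != 0 -> (k j <= k i)%N.
  by rewrite /i; case: arg_maxnP.
clearbody i.
pose v := (w 0 i)^-1 *: w.
have vi : v 0 i = 1 by rewrite mxE mulVf.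
have vL : v *m L = 0 by rewrite -scalemxAl wL scaler0.
have {}ki j : v 0 j != 0 -> (k j <= k i)%N.
  by move=> vj; apply: ki; apply: contraNneq vj => e; rewrite mxE e mulr0.
clearbody v.
(* The monomials align the degrees: all terms of entry [l] of [u' *m H] have degree at most
   [k i + k l], and the coefficient there is an entry of [v *m L], hence zero. The new [i]-th
   diagonal entry thus has degree below [2 k i]. *)
pose u' := \row_j ((v 0 j)%:P * 'X^(k i - k j)).
pose u := u' - delta_mx 0 i.
have ui : u 0 i = 0 by rewrite !mxE vi !eqxx subnn mulr1 subrr.
have g1 := reducing_form_shear ui g; have sH1 := size_det_shear H ui; rewrite sH in sH1.
rewrite ltnS in lt_s; apply: IHs g1 sH1; apply: leq_trans lt_s.
set H' := _ *m _ *m _.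
have rowi : row i (shear i u) = u'.
  apply/rowP=> j; rewrite !mxE big_ord1 !mxE !eqxx /= mul1r eq_sym; ring.
have rowj j : j != i -> row j (shear i u) = delta_mx 0 j.
  move=> ji; apply/rowP=> l; rewrite !mxE big_ord1 !mxE (negPf ji) /= mul0r addr0 eq_sym.
  by [].
have Hj j : j != i -> H' j j = H j j.
  move=> ji; rewrite /H' conj_form_diag rowj // -matrix.row1 -conj_form_diag.
  by rewrite trmx1 map_mx1 mul1mx mulmx1.
rewrite (bigD1 i) //= [X in (_ < X)%N](bigD1 i) //=.
rewrite (eq_bigr (fun j => size (H j j))) => [|j ji]; last by rewrite Hj.
rewrite ltn_add2r kd ltnS.
have gl l : (size ((u' *m H) ord0 l) <= k i + k l)%N.
  apply/leq_sizeP => m le_m; rewrite mxE coef_sum.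
  have [em|em] := eqVneq m (k i + k l)%N; last first.
    rewrite big1 // => j _; rewrite mxE -mulrA coefCM.
    have [->|/ki kj] := eqVneq (v 0 j) 0; first by rewrite mul0r.
    rewrite coefXnM; case: ltnP => h; rewrite ?mulr0 // nth_default ?mulr0 //.
    by apply: leq_trans (kH j l) _; lia.
  have /matrixP/(_ 0 l) := vL; rewrite !mxE => h; rewrite -[RHS]h; apply: eq_bigr => j _.
  rewrite !mxE -mulrA coefCM.
  have [->|/ki kj] := eqVneq (v 0 j) 0; first by rewrite !mul0r.
  rewrite coefXnM em; case: ltnP => h1; first lia.
  by congr (_ * _`_ _); lia.
have -> : H' i i = (u' *m H *m u' ^t~) 0 0 by rewrite /H' conj_form_diag rowi.
rewrite mxE; apply: leq_trans (size_sum _ _ _) _; apply/bigmax_leqP=> l _.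
rewrite !mxE.
have [->|/ki kl] := eqVneq (v 0 l) 0; first by rewrite mul0r rmorph0 mulr0 size_poly0.
have sq : (size ((v 0%R l)%:P * 'X^(k i - k l))%R <= (k i - k l).+1)%N.
  apply: leq_trans (size_polyMleq _ _) _; rewrite size_polyXn.
  by have := size_polyC_leq1 (v 0 l); lia.
have := gl l; rewrite mxE => sp.
apply: leq_trans (size_polyMleq _ _) _; rewrite size_pconj.
apply: (leq_trans (n := ((k i + k l) + (k i - k l).+1).-1)); last by lia.
by rewrite -!subn1 leq_sub2r // leq_add.
Qed.

End Normalisation.

(** * From the constant form to constant Hermitian matrices *)

Section Conclusion.
Variables (C : numClosedFieldType) (n : nat).
Variables (chi : {poly {poly C}}) (tau : {poly C}).
Implicit Types (H J M N E : 'M[{poly C}]_n) (c : {poly C}).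
Local Notation good := (reducing_form chi tau).
Local Notation "A @@ a" := (map_mx (horner_eval a) A) (at level 30).
Local Notation cst := (map_mx (@polyC C)).

(** Evaluation at a natural number where [d] does not vanish turns the identity into one over [C]:
    conjugation fixes this point, so it commutes with the evaluation. *)
Lemma sq_form_const (K : 'M[C]_n) : sq_form (cst K) -> exists S : 'M[C]_n, K = S *m S^t*.
Proof.
move=> [d [Y [d0 e]]]; have [m dm] := exists_nat_nonroot d0; set a := m%:R in dm.
have ar : a^* = a by rewrite rmorph_nat.
exists ((d.[a])^-1 *: (Y @@ a)).
have ddn0 : d.[a] * (d.[a])^* != 0 by rewrite mulf_neq0 ?conjC_eq0.
apply: (scalemx_inj ddn0).
rewrite linearZ map_mxZ -scalemxAl -scalemxAr !scalerA /=.
rewrite fmorphV -mulrA -invfM mulfV // scale1r.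
apply/matrixP=> i j; have := congr1 (fun X : 'M_n => (X i j).[a]) e.
rewrite !mxE !hornerE horner_sum -{2}ar horner_pconj => ->.
apply: eq_bigr => k _; rewrite !mxE hornerM; congr (_ * _).
by rewrite -{1}ar horner_pconj.
Qed.

Lemma reducing_form_identity (K : 'M[C]_n) J M N c : good (cst K) J M N c ->
  exists J' M' N', good 1%:M J' M' N' c.
Proof.
move=> g; have [S KS] := sq_form_const (rf_sq g).
have dS : \det S != 0.
  have := rf_det g; apply: contraNneq => e.
  by rewrite det_map_mx KS det_mulmx e mul0r.
have Su : S \in unitmx by rewrite unitmxE unitfE.
pose T := invmx S; pose E := cst S; pose E' := cst T.
have EE' : E *m E' = 1%:M by rewrite -map_mxM mulmxV // map_mx1.
have E'E : E' *m E = 1%:M by rewrite -map_mxM mulVmx // map_mx1.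
have EE't : E' ^t~ *m E ^t~ = 1%:M by rewrite -ct_mul EE' trmx1 map_mx1.
have dE : \det E != 0 by rewrite det_map_mx polyC_eq0.
exists (E' *m J *m E' ^t~), (E' *m M *m E), (E' *m N *m E).
apply: (reducing_form_conj dE) g; rewrite ?mulmxA ?EE' ?mul1mx ?mulmx1 //; last first.
  by rewrite -mulmxA EE't mulmx1.
rewrite KS map_mxM; congr (_ *m _).
by apply/matrixP=> i j; rewrite !mxE map_polyC.
Qed.

(** For the standard form, [J] is a self-adjoint idempotent and [M] is self-adjoint, so [J i i] and
    [tau] are sums of squared norms of entries of [J] and of [M]. Comparing degrees leaves [J]
    constant and [M] of degree at most one. *)
Lemma reducing_form_split H J M N c : good H J M N c -> (size tau <= 3)%N ->
  exists K0 K1 K2 : 'M[C]_n,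
    [/\ K0^t* = K0, K0 *m K0 = K0, K0 != 0 & K0 != 1%:M] /\
    [/\ K1^t* = K1, K2^t* = K2, K0 *m K1 = K1 *m K0, K0 *m K2 = K2 *m K0
      & char_poly ('X *: cst K1 + cst K2) = chi].
Proof.
move=> /reducing_form_saturate[H1 [J1 [M1 [N1 [c1 [g1 sH1 _]]]]]] stau.
have [K [J2 [M2 [N2 g2]]]] := reducing_form_constant g1 sH1.
have [{c}] := (reducing_form_identity g2, c1); move=> {H J M N g1 g2 H1 J1 M1 N1 sH1 K J2 M2 N2}.
move=> [J [M [N g]]] _.
have [_ _ Jc sa comm NN NH c0 N0 N1 gchi gtau] := g.
have {}sa : M ^t~ = M by move: sa; rewrite mulmx1 mul1mx.
have NJ : N = c1 *: J by rewrite -NH mulmx1.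
have JJ : J *m J = J.
  apply: (scalemx_inj (mulf_neq0 c0 c0)).
  by rewrite -!scalerA -NJ -NN NJ -scalemxAl -scalemxAr.
have JM : J *m M = M *m J.
  by apply: (scalemx_inj c0); rewrite scalemxAl scalemxAr -NJ.
have entry (A : 'M[{poly C}]_n) : A ^t~ = A -> forall i j, A j i = pconj (A i j).
  by move=> Ac i j; rewrite -{1}Ac !mxE.
have sqJ i : J i i = \sum_k J i k * pconj (J i k).
  by rewrite -{1}JJ mxE; apply: eq_bigr => k _; rewrite (entry _ Jc i k).
(* The bound at [(i, i)] makes [J i i] constant, and then [J i i] bounds the rest of its row. *)
have sJ i j : (size (J i j) <= 1)%N.
  have := size_sum_sqr_norm_ge (J i) i; have := size_sum_sqr_norm_ge (J i) j.
  by rewrite -sqJ; lia.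
have sM i j : (size (M i j) <= 2)%N.
  have := size_sum_sqr_norm_ge (fun p : 'I_n * 'I_n => M p.1 p.2) (i, j) => /=.
  rewrite -(pair_bigA _ (fun i j => M i j * pconj (M i j))) /=.
  have -> : \sum_i \sum_j M i j * pconj (M i j) = tau.
    rewrite -gtau /mxtrace; apply: eq_bigr => k _; rewrite mxE.
    by apply: eq_bigr => l _; rewrite (entry _ sa k l).
  by move=> /leq_trans/(_ (stau : (size tau < 4)%N)); rewrite addnn (leq_double _ 2).
have cstJ := poly_mx_const sJ; set K0 := map_mx (coefp 0) J in cstJ.
pose K1 := map_mx (coefp 1) M; pose K2 := map_mx (coefp 0) M.
have coefK k (A : 'M[{poly C}]_n) (B : 'M[C]_n) i j :
    map_mx (coefp k) (A *m cst B) i j = (map_mx (coefp k) A *m B) i j.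
  by rewrite !mxE /= coef_sum; apply: eq_bigr => l _; rewrite !mxE coefMC.
have coefK' k (A : 'M[{poly C}]_n) (B : 'M[C]_n) i j :
    map_mx (coefp k) (cst B *m A) i j = (B *m map_mx (coefp k) A) i j.
  by rewrite !mxE /= coef_sum; apply: eq_bigr => l _; rewrite !mxE coefCM.
have hermK k (A : 'M[{poly C}]_n) : A ^t~ = A -> (map_mx (coefp k) A)^t* = map_mx (coefp k) A.
  by move=> Ac; apply/matrixP=> i j; rewrite !mxE /= [in RHS](entry _ Ac j i) coef_map.
exists K0, K1, K2; split; split.
- exact: hermK.
- have : cst (K0 *m K0) = cst K0 by rewrite map_mxM -cstJ.
  move=> /matrixP e; apply/matrixP=> i j; apply: polyC_inj.
  by have := e i j; rewrite [LHS]mxE [RHS]mxE.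
- by apply: contraNneq N0 => e; rewrite NJ cstJ e map_mx0 scaler0.
- by apply: contraNneq N1 => e; rewrite NJ cstJ e map_mx1 scalemx1.
- exact: hermK.
- exact: hermK.
- by apply/matrixP=> i j; rewrite -coefK' -coefK -cstJ JM.
- by apply/matrixP=> i j; rewrite -coefK' -coefK -cstJ JM.
rewrite -gchi; congr char_poly; apply/matrixP=> i j; rewrite !mxE /=.
apply/polyP=> k; rewrite coefD mulrC coefMX coefC coefC.
case: k => [|[|k]] /=; rewrite ?addr0 ?add0r //.
by rewrite nth_default // (leq_trans (sM i j)).
Qed.

End Conclusion.

(** * Invariant subspaces over the field of rational functions *)

(** The Krylov space of [e], spanned by [e A^i] for [i] below the degree of [p], is stable because
    powers of [A] reduce modulo [p]. It contains [e], and its dimension is at most the degree of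
    [p], hence at most [n]. *)
Lemma annihilated_invariant (K : fieldType) n (A : 'M[K]_n.+1) (p : {poly K}) :
    horner_mx A p = 0 -> (1 < size p)%N -> (size p <= n.+1)%N ->
  exists2 W : 'M[K]_n.+1, stablemx W A & (0 < \rank W < n.+1)%N.
Proof.
move=> pA p1 pn; pose d := (size p).-1.
have p0 : p != 0 by rewrite -size_poly_gt0 ltnW.
pose e : 'rV[K]_n.+1 := delta_mx 0 0.
pose W := \matrix_(i < d) (e *m A ^+ i).
have Wr (r : {poly K}) : (size r <= d)%N -> (e *m horner_mx A r <= W)%MS.
  move=> sr; rewrite -(take_poly_id sr) /take_poly poly_def rmorph_sum /= mulmx_sumr.
  apply: summx_sub => i _; rewrite horner_mxZ rmorphXn /= horner_mx_X -scalemxAr.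
  by apply: scalemx_sub; rewrite -(rowK (fun i : 'I_d => e *m A ^+ i)) row_sub.
exists <<W>>%MS.
  rewrite (eqmxMr _ (genmxE W)) genmxE; apply/row_subP => i.
  rewrite row_mul rowK -mulmxA mulmxE -exprSr.
  have -> : A ^+ i.+1 = horner_mx A ('X^(i.+1) %% p).
    rewrite -{1}(horner_mx_X A) -rmorphXn /= {1}(divp_eq 'X^(i.+1) p).
    by rewrite rmorphD rmorphM /= pA mulr0 add0r.
  by apply: Wr; rewrite -ltnS prednK ?ltn_modp // size_poly_gt0.
rewrite genmxE; apply/andP; split.
  rewrite lt0n mxrank_eq0; apply/eqP=> W0.
  have /Wr/submxP[D] : (size (1%R : {poly K}) <= d)%N by rewrite size_poly1 -ltnS prednK // ltnW.
  rewrite rmorph1 mulmx1 W0 mulmx0 => /matrixP/(_ 0 0); rewrite !mxE !eqxx => /eqP.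
  by rewrite oner_eq0.
by apply: leq_ltn_trans (rank_leq_row _) _; rewrite prednK // ltnW.
Qed.

(** If neither factor annihilates [A], the kernel of [p(A)] is proper because [p(A)] is nonzero, and
    nontrivial because [q(A) p(A) = 0] by Cayley-Hamilton. If one does, its degree is small enough
    for a Krylov space. *)
Lemma reducible_invariant (K : fieldType) n (A : 'M[K]_n) (p q : {poly K}) :
    char_poly A = p * q -> (1 < size p)%N -> (1 < size q)%N ->
  exists2 W : 'M[K]_n, stablemx W A & (0 < \rank W < n)%N.
Proof.
case: n A => [|n] A cA p1 q1; have := size_char_poly A; rewrite cA.
all: have p0 : p != 0 by rewrite -size_poly_gt0 ltnW.
all: have q0 : q != 0 by rewrite -size_poly_gt0 ltnW.
all: rewrite size_mul // => spq.
  by move: p1 q1 spq; case: (size p) => [|[|a]] // ; case: (size q) => [|[|b]] //; rewrite !addnS.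
have aux a b : (1 < a -> 1 < b -> (a + b).-1 = n.+2 -> (a <= n.+1) && (b <= n.+1))%N by lia.
have /andP[sp sq] := aux _ _ p1 q1 spq.
have [pA|pA] := eqVneq (horner_mx A p) 0.
  exact: annihilated_invariant pA p1 sp.
have [qA|qA] := eqVneq (horner_mx A q) 0.
  exact: annihilated_invariant qA q1 sq.
exists (kermx (horner_mx A p)).
  by apply: comm_mx_stable_ker; apply: comm_horner_mx.
rewrite lt0n mxrank_eq0 kermx_eq0 ltn_neqAle rank_leq_row andbT; apply/andP; split.
  apply/negP=> fA; move/eqP: qA; apply; apply: (row_free_inj fA).
  rewrite mul0mx mulmxE (comm_horner_mx2 A q p) -rmorphM /= -cA.
  exact: Cayley_Hamilton.
rewrite mxrank_ker; apply: contraNneq pA => h; rewrite -mxrank_eq0.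
by have := rank_leq_row (horner_mx A p); lia.
Qed.

Local Notation "x %:F" := (@FracField.tofrac _ x).

Lemma tofrac_inj (R : idomainType) : injective (@FracField.tofrac R).
Proof. by move=> a b /eqP; rewrite tofrac_eq => /eqP. Qed.

Lemma common_denominator (R : idomainType) m n (Y : 'M[{fraction R}]_(m, n)) :
  exists (d : R) (B : 'M[R]_(m, n)), d != 0 /\ map_mx (@FracField.tofrac R) B = d%:F *: Y.
Proof.
have frac (x : {fraction R}) : exists a b : R, b != 0 /\ b%:F * x = a%:F.
  elim/quotW: x => x; exists \n_x, \d_x; split; first exact: denom_ratioP.
  unlock FracField.tofrac; rewrite -[LHS]FracField.pi_mul; apply/eqmodP.
  rewrite /= FracField.equivfE /FracField.mulf.
  by rewrite !numden_Ratio ?oner_neq0 ?mulf_neq0 ?denom_ratioP ?mul1r ?mulr1 ?oner_neq0 // mulrC.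
have {}frac x : exists ab : R * R, ab.2 != 0 /\ ab.2%:F * x = ab.1%:F.
  by have [a [b]] := frac x; exists (a, b).
have [f fP] : exists f : {ffun 'I_m * 'I_n -> R * R},
    forall i, (f i).2 != 0 /\ (f i).2%:F * Y i.1 i.2 = (f i).1%:F.
  have /fin_all_exists[f fP] := fun i : 'I_m * 'I_n => frac (Y i.1 i.2).
  by exists [ffun i => f i] => i; rewrite ffunE.
exists (\prod_i (f i).2), (\matrix_(i, j) ((f (i, j)).1 * \prod_(k | k != (i, j)) (f k).2)).
split; first by apply/prodf_neq0 => i _; case: (fP i).
apply/matrixP=> i j; rewrite !mxE [in RHS](bigD1 (i, j)) //= tofracM tofracM mulrAC.
by have [_ ->] := fP (i, j).
Qed.

(** Let [B] be a basis of an invariant subspace, cleared of denominators. Its Gram matrix [G] is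
    nonsingular, since a sum of squared norms vanishes only termwise, and [B^H G^-1 B] is the
    orthogonal projection onto the subspace; [N] is this projection times [c = \det G]. *)
Lemma reducing_form_exists (C : numClosedFieldType) n (M : 'M[{poly C}]_n)
    (p q : {poly {poly C}}) :
    M ^t~ = M -> char_poly M = p * q -> (1 < size p)%N -> (1 < size q)%N ->
  exists H J N c, reducing_form (char_poly M) (\tr (M *m M)) H J M N c.
Proof.
move=> Mc cM p1 q1.
pose toF := @FracField.tofrac {poly C}.
have toF_inj : injective toF by exact: tofrac_inj.
have mxF_inj m k : injective (map_mx toF : 'M_(m, k) -> _).
  by move=> X Y /matrixP e; apply/matrixP=> i j; apply: toF_inj; have := e i j; rewrite !mxE.
have [|||W Ws rW] := @reducible_invariant _ _ (map_mx toF M) (map_poly toF p) (map_poly toF q).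
- by rewrite -map_char_poly cM rmorphM.
- by rewrite size_map_inj_poly // rmorph0.
- by rewrite size_map_inj_poly // rmorph0.
have /submxP[X WX] : (row_base W *m map_mx toF M <= row_base W)%MS.
  by rewrite (eqmxMr _ (eq_row_base W)) eq_row_base.
have [d [B [d0 BE]]] := common_denominator (row_base W).
have dF0 : d%:F != 0 by rewrite tofrac_eq0.
have BM : map_mx toF B *m map_mx toF M = X *m map_mx toF B.
  by rewrite BE -scalemxAl WX scalemxAr.
have Bfree : row_free (map_mx toF B).
  by rewrite BE /row_free mxrank_scale_nz // -/(row_free _) row_base_free.
have Binj k (u v : 'M_(k, _)) : u *m B = v *m B -> u = v.
  move=> /(congr1 (map_mx toF)); rewrite !map_mxM => e.
  by apply: mxF_inj; apply: (row_free_inj Bfree).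
pose G := B *m B ^t~; pose c := \det G.
have Gc : G ^t~ = G by rewrite ct_mul ctK.
have adjGc : (\adj G) ^t~ = \adj G by rewrite trmx_adj map_mx_adj Gc.
have cc : pconj c = c by rewrite -det_ct Gc.
have c0 : c != 0.
  apply/negP=> /det0P[v v0]; rewrite mulmxA => vG; case/eqP: v0.
  apply: Binj; rewrite mul0mx; apply/rowP=> i; rewrite [RHS]mxE.
  apply: (sum_sqr_norm_eq0 (f := fun i => (v *m B) 0 i)).
  have /matrixP/(_ 0 0) : v *m B *m (v *m B) ^t~ = 0 by rewrite ct_mul mulmxA vG mul0mx.
  rewrite mxE [RHS]mxE => e; rewrite -[RHS]e; apply: eq_bigr => j _.
  by congr (_ * _); rewrite !mxE.
pose N := B ^t~ *m \adj G *m B.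
have BN : B *m N = c *: B.
  by rewrite /N !mulmxA -/G mul_mx_adj mul_scalar_mx.
have Nc : N ^t~ = N by rewrite !ct_mul ctK adjGc mulmxA.
have NN : N *m N = c *: N by rewrite {1}/N -mulmxA BN -scalemxAr.
have BMN : B *m M *m N = c *: (B *m M).
  have BNF : map_mx toF B *m map_mx toF N = toF c *: map_mx toF B.
    by rewrite -map_mxM BN map_mxZ.
  have MF : map_mx toF (B *m M) = X *m map_mx toF B by rewrite map_mxM BM.
  apply: mxF_inj; transitivity (map_mx toF (B *m M) *m map_mx toF N); first exact: map_mxM.
  transitivity (toF c *: map_mx toF (B *m M)); last by rewrite map_mxZ.
  by rewrite MF -mulmxA BNF -scalemxAr.
have NMN : N *m M *m N = c *: (N *m M).
  transitivity (B ^t~ *m \adj G *m (B *m M *m N)); first by rewrite /N !mulmxA.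
  by rewrite BMN -scalemxAr /N !mulmxA.
have rN : (\rank (map_mx toF N) <= \rank (map_mx toF B))%N by rewrite /N map_mxM mxrankM_maxr.
clearbody N.
(* Invariance gives [N M N = c N M]; the adjoint of this equation is [N M N = c M N]. *)
have comm : N *m M = M *m N.
  apply: (scalemx_inj c0); have := congr1 (fun X => X ^t~) NMN.
  by rewrite ctZ !ct_mul Nc Mc cc -NMN mulmxA.
have rB : (0 < \rank (map_mx toF B) < n)%N by rewrite (eqP Bfree).
(* The identity form is rescaled by [c * pconj c], so that its image [J] under [N / c] is
   polynomial. *)
exists (c * pconj c)%:M, (c *: N), N, c; split=> //.
- exists 1, c%:M; split; first exact: oner_neq0.
  by rewrite rmorph1 mul1r scale1r ct_scalar -scalar_mxM.
- by rewrite det_scalar expf_neq0 // mulf_neq0 ?pconj_eq0.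
- by rewrite ctZ Nc cc.
- by rewrite mul_mx_scalar mul_scalar_mx Mc.
- by rewrite mul_mx_scalar cc scalerA.
- apply: contraTneq rB => N0; move: BN; rewrite N0 mulmx0 => /esym/eqP.
  by rewrite scalemx_eq0 (negPf c0) /= => /eqP->; rewrite map_mx0 mxrank0.
- apply: contraTneq rB => e; rewrite negb_and -!leqNgt; apply/orP; right.
  have Fc0 : toF c != 0 by rewrite tofrac_eq0.
  have mN : map_mx toF N = (toF c)%:M by rewrite e map_scalar_mx.
  have mu : map_mx toF N \in unitmx.
    by rewrite mN unitmxE det_scalar unitfE; exact: expf_neq0.
  by rewrite (mxrank_unit mu) in rN; exact: rN.
Qed.

(** * Base polynomials *)
From mathcomp.multinomials Require Import mpoly.

Section BasePoly.
Variable C : numClosedFieldType.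

Lemma H1_herm n (A : 'M[C]_n) : (H1 A)^t* = H1 A.
Proof.
rewrite /H1 linearZ map_mxZ linearD map_mxD /= trmxCK addrC.
by rewrite fmorphV rmorph_nat.
Qed.

Lemma H2_herm n (A : 'M[C]_n) : (H2 A)^t* = H2 A.
Proof.
rewrite /H2 linearZ map_mxZ linearB map_mxB /= trmxCK.
by rewrite fmorphV rmorphM /= rmorph_nat conjCi mulrN invrN scaleNr -scalerN opprB.
Qed.

Lemma two_i_neq0 : 2 * 'i != 0 :> C.
Proof. by rewrite mulf_neq0 ?pnatr_eq0 ?neq0Ci. Qed.

Lemma H12K n (A : 'M[C]_n) : A = H1 A + 'i *: H2 A.
Proof.
rewrite /H1 /H2 scalerA invfM mulrCA mulfV ?neq0Ci // mulr1 -scalerDr.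
by rewrite addrACA subrr addr0 -mulr2n -scaler_nat scalerA mulVf ?pnatr_eq0 // scale1r.
Qed.

Lemma ctr_rect n (K1 K2 : 'M[C]_n) : K1^t* = K1 -> K2^t* = K2 ->
  (K1 + 'i *: K2)^t* = K1 - 'i *: K2.
Proof.
by move=> K1c K2c; rewrite linearD map_mxD linearZ map_mxZ /= K1c K2c conjCi scaleNr.
Qed.

Lemma H1_rect n (K1 K2 : 'M[C]_n) : K1^t* = K1 -> K2^t* = K2 -> H1 (K1 + 'i *: K2) = K1.
Proof.
move=> K1c K2c; rewrite /H1 ctr_rect // addrACA subrr addr0 -mulr2n -scaler_nat.
by rewrite scalerA mulVf ?pnatr_eq0 // scale1r.
Qed.

Lemma H2_rect n (K1 K2 : 'M[C]_n) : K1^t* = K1 -> K2^t* = K2 -> H2 (K1 + 'i *: K2) = K2.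
Proof.
move=> K1c K2c; rewrite /H2 ctr_rect // opprB [_ + (_ - K1)]addrC addrA subrK -mulr2n -scaler_nat.
by rewrite !scalerA -mulrA mulVf ?two_i_neq0 // scale1r.
Qed.

Lemma mmap_base_poly n (A : 'M[C]_n) (S : comNzRingType) (f : {rmorphism C -> S}) (h : 'I_3 -> S) :
  mmap f h (base_poly A) = \det (h (inord 0) *: map_mx f (H1 A)
    + h (inord 1) *: map_mx f (H2 A) + (h (inord 2))%:M).
Proof.
rewrite /base_poly -det_map_mx; congr (\det _); apply/matrixP=> i j.
by rewrite !mxE !rmorphD !rmorphM /= rmorphMn /= !mmapC !mmapX !mmap1U.
Qed.

Definition real_pencil n (A : 'M[C]_n) : 'M[{poly C}]_n :=
  'X *: map_mx (@polyC C) (H1 A) + map_mx (@polyC C) (H2 A).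

Lemma real_pencil_herm n (A : 'M[C]_n) : (real_pencil A)^t~ = real_pencil A.
Proof.
have := H1_herm A; have := H2_herm A; rewrite /real_pencil.
move: (H1 A) (H2 A) => P Q Qc Pc; apply/matrixP=> i j.
by rewrite -[in RHS]Pc -[in RHS]Qc !mxE rmorphD rmorphM /= map_polyX !map_polyC.
Qed.

Lemma size_tr_sqr_real_pencil n (A : 'M[C]_n) :
  (size (\tr (real_pencil A *m real_pencil A)) <= 3)%N.
Proof.
have s2 i j : (size (real_pencil A i j) <= 2)%N.
  rewrite /real_pencil; move: (H1 A) (H2 A) => P Q.
  rewrite !mxE; apply: leq_trans (size_polyD _ _) _; rewrite geq_max.
  apply/andP; split; last by apply: leq_trans (size_polyC_leq1 _) _.
  apply: leq_trans (size_polyMleq _ _) _; rewrite size_polyX.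
  exact: size_polyC_leq1.
apply: leq_trans (size_sum _ _ _) _; apply/bigmax_leqP=> i _; rewrite mxE.
apply: leq_trans (size_sum _ _ _) _; apply/bigmax_leqP=> j _.
apply: leq_trans (size_polyMleq _ _) _; rewrite -subn1 leq_subLR.
exact: leq_add (s2 i j) (s2 j i).
Qed.

(* The sign of the last coordinate turns [t + M] into minus a characteristic matrix. *)
Definition affine_chart : {mpoly C[3]} -> {poly {poly C}} :=
  mmap (polyC \o (@polyC C)) (fun i : 'I_3 =>
    if i == inord 0 then 'X%:P else if i == inord 1 then 1 else - 'X).

Lemma affine_chart_base_poly n (A : 'M[C]_n) :
  affine_chart (base_poly A) = (-1) ^+ n * char_poly (real_pencil A).
Proof.
rewrite /affine_chart mmap_base_poly eqxx -!val_eqE /= !inordK //=.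
rewrite /char_poly /real_pencil; move: (H1 A) (H2 A) => P Q.
rewrite -detZ; congr (\det _); apply/matrixP=> i j.
rewrite !mxE !rmorphD rmorphM /= !mul1r mulN1r opprB.
by rewrite mulNrn.
Qed.

End BasePoly.

Section BasePolyFactor.
Variable C : numClosedFieldType.

Lemma size_affine_chart (p : {mpoly C[3]}) : (size (affine_chart p) <= msize p)%N.
Proof.
rewrite /affine_chart /mmap; apply: leq_trans (size_sum _ _ _) _.
apply/bigmax_leqP_seq => m mp _; apply: leq_trans (msize_mdeg_lt mp).
rewrite /= mul_polyC; apply: leq_trans (size_scale_leq _ _) _.
rewrite mdegE; apply: size_prod_le => i.
apply: (leq_trans (size_poly_exp_leq _ _)); rewrite ltnS.
suff : (size (if i == inord 0 then 'X%:P else if i == inord 1 then 1 else - 'X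
  : {poly {poly C}})%R <= 2)%N.
  by case: (size _) => [|[|[|s]]] //= _; rewrite ?mul0n ?mul1n.
case: ifP => _; first by apply: leq_trans (size_polyC_leq1 _) _.
by case: ifP => _; rewrite ?size_poly1 // size_polyN size_polyX.
Qed.

Lemma msizeM_leq k (p q : {mpoly C[k]}) : (msize (p * q) <= (msize p + msize q).-1)%N.
Proof.
have [->|p0] := eqVneq p 0; first by rewrite mul0r msize0.
have [->|q0] := eqVneq q 0; first by rewrite mulr0 msize0.
by rewrite msizeM.
Qed.

Lemma msize_prod_le k (I : Type) (r : seq I) (f : I -> {mpoly C[k]}) :
  (forall i, (msize (f i) <= 2)%N) -> (msize (\prod_(i <- r) f i)%R <= (size r).+1)%N.
Proof.
move=> sf; elim: r => [|i r IHr]; first by rewrite big_nil msize1.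
rewrite big_cons; apply: leq_trans (msizeM_leq _ _) _.
by rewrite -subn1 leq_subLR; exact: leq_add (sf i) IHr.
Qed.

Lemma msize_base_poly n (A : 'M[C]_n) : (msize (base_poly A) <= n.+1)%N.
Proof.
rewrite /base_poly; move: (H1 A) (H2 A) => P Q.
set X := (_ + _ : 'M_n).
have sX i j : (msize (X i j) <= 2)%N.
  have sXi k : (msize ('X_k : {mpoly C[3]})%R <= 2)%N by rewrite msizeX mdeg1.
  have sXc k (c : C) : (msize ('X_k * c%:MP : {mpoly C[3]})%R <= 2)%N.
    by rewrite mulrC mul_mpolyC; apply: leq_trans (msizeZ_le _ _) _.
  rewrite !mxE; apply: leq_trans (msizeD_le _ _) _; rewrite geq_max; apply/andP; split.
    by apply: leq_trans (msizeD_le _ _) _; rewrite geq_max !sXc.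
  by case: (i == j); rewrite ?mulr1n ?mulr0n ?msize0.
apply: leq_trans (msize_sum _ _ _) _; apply/bigmax_leqP=> s _.
have -> : ((-1) ^+ s : {mpoly C[3]}) = ((-1) ^+ s)%:MP by rewrite rmorphXn /= rmorphN1.
rewrite mul_mpolyC; apply: leq_trans (msizeZ_le _ _) _.
have := @msize_prod_le 3 _ (index_enum 'I_n) (fun i => X i (s i)) (fun i => sX i (s i)).
by rewrite [index_enum _]unlock -enumT size_enum_ord.
Qed.

(** The chart does not raise degrees, [base_poly A] has degree at most [n], and the characteristic
    polynomial has degree exactly [n]. Hence neither factor loses degree in the chart, and both stay
    nonconstant. *)
Lemma char_poly_reducible n (A : 'M[C]_n) : poly_reducible (base_poly A) ->
  exists p q : {poly {poly C}},
    [/\ char_poly (real_pencil A) = p * q, (1 < size p)%N & (1 < size q)%N].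
Proof.
move=> [p [q [sp sq F]]].
have cE : char_poly (real_pencil A) = ((-1) ^+ n * affine_chart p) * affine_chart q.
  have : affine_chart (base_poly A) = affine_chart p * affine_chart q.
    by rewrite F /affine_chart rmorphM.
  by rewrite affine_chart_base_poly -mulrA => <-; rewrite mulrA -expr2 sqrr_sign mul1r.
have p0 : p != 0 by rewrite -msize_poly_eq0 -lt0n ltnW.
have q0 : q != 0 by rewrite -msize_poly_eq0 -lt0n ltnW.
have := msize_base_poly A; rewrite F msizeM // => sF.
have := size_char_poly (real_pencil A); rewrite cE.
have szs : size ((-1) ^+ n * affine_chart p) = size (affine_chart p).
  by rewrite -signr_odd; case: odd; rewrite ?mulN1r ?mul1r ?size_polyN.
have := size_polyMleq ((-1) ^+ n * affine_chart p) (affine_chart q); rewrite szs => le1 eq1.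
exists ((-1) ^+ n * affine_chart p), (affine_chart q); rewrite szs.
rewrite eq1 in le1.
have := size_affine_chart p; have := size_affine_chart q; clear - sp sq sF le1.
move: (size _) (size _) (msize p) (msize q) le1 sp sq sF => a b c d *.
by split=> //; lia.
Qed.

Lemma horner_char_poly (R : comNzRingType) n (M : 'M[R]_n) s :
  (char_poly M).[s] = \det (s%:M - M).
Proof.
rewrite -[LHS]/(horner_eval s _) /char_poly -det_map_mx; congr (\det _).
by apply/matrixP=> i j; rewrite !mxE /= /horner_eval hornerD hornerN hornerMn hornerX hornerC.
Qed.

Lemma horner_linear (R : comNzRingType) (a b s : R) :
  ('X * a%:P + b%:P).[s] = s * a + b.
Proof. by rewrite !hornerE. Qed.

Lemma tofrac_linear (R : idomainType) (x y t c d : R) k :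
  (x * c + y * d + t *+ k)%:F = x%:F * c%:F + y%:F * d%:F + t%:F *+ k.
Proof. by rewrite !tofracD !tofracM tofracMn. Qed.

Lemma dehomogenise (K : fieldType) (x y t c d : K) (b : bool) : y != 0 ->
  x * c + y * d + t *+ b = - y * (- t / y *+ b - (x / y * c + d)).
Proof. by move=> y0; case: b; rewrite ?mulr1n ?mulr0n; field. Qed.

(* Homogenisation: [t + x H1 + y H2 = - y (- t / y - (x / y * H1 + H2))]. *)
Lemma base_poly_pencil n (A B : 'M[C]_n) :
  char_poly (real_pencil A) = char_poly (real_pencil B) -> base_poly A = base_poly B.
Proof.
pose R : idomainType := {mpoly C[3]}.
pose K : fieldType := {fraction R}.
pose f : {rmorphism C -> K} := @FracField.tofrac R \o @mpolyC 3 C.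
pose X i : K := ('X_(inord i) : R)%:F.
have X1 : X 1%N != 0 by rewrite tofrac_eq0 -msize_poly_eq0 msizeX mdeg1.
(* [g] substitutes [x / y] for the inner variable; the outer one is evaluated at [- t / y]. *)
pose g : {rmorphism {poly C} -> K} := horner_eval (X 0%N / X 1%N) \o map_poly f.
have baseE (D : 'M[C]_n) : (base_poly D : R)%:F =
    (- X 1%N) ^+ n * (map_poly g (char_poly (real_pencil D))).[- X 2%N / X 1%N].
  rewrite map_char_poly horner_char_poly -detZ -det_map_mx /real_pencil.
  move: (H1 D) (H2 D) => P Q; congr (\det _); apply/matrixP=> i j.
  rewrite !mxE /g /= /horner_eval.
  have -> : map_poly (@FracField.tofrac R \o @mpolyC 3 C) ('X * (P i j)%:P + (Q i j)%:P)
      = 'X * (f (P i j))%:P + (f (Q i j))%:P.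
    by rewrite rmorphD rmorphM /= map_polyX !map_polyC.
  rewrite (@horner_linear K).
  rewrite (@tofrac_linear R).
  rewrite -/(X 0%N) -/(X 1%N) -/(X 2%N) -/(f (P i j)) -/(f (Q i j)).
  exact: dehomogenise.
move=> e; have eF : (base_poly A : R)%:F = (base_poly B : R)%:F.
  exact: etrans (baseE A) (etrans (congr1 (fun P : {poly {poly C}} =>
    (- X 1%N) ^+ n * (map_poly g P).[- X 2%N / X 1%N]) e) (esym (baseE B))).
exact: (@tofrac_inj R) eF.
Qed.
End BasePolyFactor.

(** * Block diagonalisation *)

Section BlockDiagonal.
Variable C : numClosedFieldType.

(** [m] and [n] are kept apart because the unitary matrix is later stacked from blocks whose sizes
    are only provably of sum [n]. *)
Lemma det_conj_unitary m n (U : 'M[C]_(m, n)) (S : comNzRingType) (f : {rmorphism C -> S})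
    (P Q : 'M[C]_n) (x y t : S) : m = n -> U *m U^t* = 1%:M ->
  \det (x *: map_mx f (U *m P *m U^t*) + y *: map_mx f (U *m Q *m U^t*) + t%:M) =
  \det (x *: map_mx f P + y *: map_mx f Q + t%:M).
Proof.
move=> e; subst m => UU.
have dU : \det (map_mx f U) * \det (map_mx f (U^t*)) = 1.
  by rewrite -det_mulmx -map_mxM UU map_mx1 det1.
rewrite -[RHS]mul1r -dU mulrAC -!det_mulmx; congr (\det _).
rewrite 2!mulmxDr 2!mulmxDl -!scalemxAr -!scalemxAl -!map_mxM; congr (_ + _).
by rewrite mul_mx_scalar -scalemxAl -map_mxM UU map_mx1 scalemx1.
Qed.

Lemma base_poly_unitary m n (U : 'M[C]_(m, n)) (A : 'M[C]_n) : m = n ->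
  U *m U^t* = 1%:M -> base_poly (U *m A *m U^t*) = base_poly A.
Proof.
move=> mn UU.
have ctU : (U *m A *m U^t*)^t* = U *m A^t* *m U^t*.
  by rewrite !trmx_mul !map_mxM trmxCK mulmxA.
rewrite /base_poly /H1 /H2 ctU -mulmxDl -mulmxDr -mulmxBl -mulmxBr.
have pull c X : c *: (U *m X *m U^t*) = U *m (c *: X) *m U^t*.
  by rewrite -scalemxAr -scalemxAl.
by rewrite !pull (@det_conj_unitary _ _ U {mpoly C[3]} (@mpolyC 3 C)).
Qed.

Lemma base_poly_cast m n (e : m = n) (A : 'M[C]_m) : base_poly (castmx (e, e) A) = base_poly A.
Proof. by subst m; rewrite castmx_id. Qed.

(** Orthonormal bases of the row spaces of [K] and [1 - K], stacked, form a unitary [U]. As [A]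
    commutes with both projections, the off-diagonal blocks of [U A U^H] vanish. *)
Lemma block_diagonal_of_projection n (K A : 'M[C]_n) :
    K^t* = K -> K *m K = K -> K != 0 -> K != 1%:M -> K *m A = A *m K ->
  exists2 A' : 'M[C]_n, block_diagonal A' & base_poly A' = base_poly A.
Proof.
move=> Kc KK K0 K1 KA.
pose Pi (i : 'I_2) := if i == 0 then K else 1%:M - K.
have KK' : K *m (1%:M - K) = 0 by rewrite mulmxBr mulmx1 KK subrr.
have K'K : (1%:M - K) *m K = 0 by rewrite mulmxBl mul1mx KK subrr.
have PiPi i j : Pi i *m Pi j = if i == j then Pi i else 0.
  case: i j => [[|[|i]] hi] [[|[|j]] hj] //; rewrite /Pi -!val_eqE /= //.
  by rewrite mulmxBr mulmx1 K'K subr0.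
have Pic i : (Pi i)^t* = Pi i.
  by rewrite /Pi; case: ifP => // _; rewrite linearB map_mxB /= Kc trmx1 map_mx1.
have PiA i : Pi i *m A = A *m Pi i.
  by rewrite /Pi; case: ifP => // _; rewrite mulmxBl mulmxBr mul1mx mulmx1 KA.
have Pi0 i : Pi i != 0.
  by rewrite /Pi; case: ifP => // _; rewrite subr_eq0 eq_sym.
pose p i := \rank (Pi i).
pose B i : 'M[C]_(p i, n) := schmidt (row_base (Pi i)).
have BB i : B i *m (B i)^t* = 1%:M.
  by apply/unitarymxP; apply: schmidt_unitarymx; exact: rank_leq_row.
have BPi i : B i *m Pi i = B i.
  have /submxP[D ->] : (B i <= Pi i)%MS.
    by rewrite /B eqmx_schmidt_free ?row_base_free // eq_row_base.
  by rewrite -mulmxA PiPi eqxx.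
have BXB i j (X : 'M_n) : i != j -> Pi i *m X = X *m Pi i -> B i *m X *m (B j)^t* = 0.
  move=> ij PX; rewrite -[B i]BPi -[B j]BPi trmx_mul map_mxM Pic.
  rewrite -!mulmxA (mulmxA (Pi i)) PX -!mulmxA (mulmxA (Pi i)) PiPi (negPf ij).
  by rewrite mul0mx !mulmx0.
pose U := \mxcol_i B i.
have Uct : U^t* = \mxrow_j (B j)^t*.
  by rewrite tr_mxcol; apply/matrixP=> i j; rewrite !mxE.
have UXU (X : 'M_n) : (forall i, Pi i *m X = X *m Pi i) ->
    U *m X *m U^t* = \mxdiag_i (B i *m X *m (B i)^t*).
  move=> PX; rewrite Uct mxcol_mul mul_mxcol_mxrow /mxdiag; apply/eq_mxblock => i j.
  by case: eqVneq => [->|ij]; rewrite ?conform_mx_id // BXB.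
(* The ranks add up to [n]: the sum of the two projections is the identity, and the row space of
   [1 - K] lies in the kernel of [K]. *)
have e : (\sum_i p i)%N = n.
  rewrite big_ord_recl big_ord1 /p /Pi /=.
  pose K' : 'M[C]_n := 1%:M - K; rewrite -/K'.
  have r1 : (n <= \rank K + \rank K')%N.
    by have := mxrank_add K K'; rewrite /K' addrC subrK mxrank1.
  have r2 : (\rank K' <= n - \rank K)%N.
    by rewrite -mxrank_ker; apply: mxrankS; apply/sub_kermxP; exact: K'K.
  by have := rank_leq_row K; lia.
have UU : U *m U^t* = 1%:M.
  rewrite -[U in U *m _]mulmx1 UXU => [|i]; last by rewrite mulmx1 mul1mx.
  by rewrite -(mxdiagZ 1); apply/eq_mxdiag => i; rewrite mulmx1 BB.
exists (castmx (e, e) (U *m A *m U^t*)).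
  exists 2, p, (fun i => B i *m A *m (B i)^t*), e; split=> //.
    by move=> i; rewrite lt0n mxrank_eq0.
  by rewrite UXU.
by rewrite base_poly_cast base_poly_unitary.
Qed.
End BlockDiagonal.

(** * Numerical range *)
From mathcomp Require Import boolp classical_sets.

Section SesquilinearForm.
Variable C : numClosedFieldType.
Variable n : nat.
Implicit Types (P Q : 'M[C]_n) (x y : 'cV[C]_n).

Definition sesqf P x y : C := (x^t* *m P *m y) 0 0.

Lemma sesqfDr P x y z : sesqf P x (y + z) = sesqf P x y + sesqf P x z.
Proof. by rewrite /sesqf mulmxDr mxE. Qed.

Lemma sesqfZr P x a y : sesqf P x (a *: y) = a * sesqf P x y.
Proof. by rewrite /sesqf -scalemxAr mxE. Qed.

Lemma sesqfDl P x y z : sesqf P (x + y) z = sesqf P x z + sesqf P y z.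
Proof. by rewrite /sesqf linearD map_mxD !mulmxDl mxE. Qed.

Lemma sesqfZl P a x y : sesqf P (a *: x) y = a^* * sesqf P x y.
Proof. by rewrite /sesqf linearZ map_mxZ -!scalemxAl mxE. Qed.

Lemma sesqfDm P Q x y : sesqf (P + Q) x y = sesqf P x y + sesqf Q x y.
Proof. by rewrite /sesqf mulmxDr mulmxDl mxE. Qed.

Lemma sesqfZm a P x y : sesqf (a *: P) x y = a * sesqf P x y.
Proof. by rewrite /sesqf -scalemxAr -scalemxAl mxE. Qed.

Lemma sesqf_herm P x y : P^t* = P -> sesqf P y x = (sesqf P x y)^*.
Proof.
move=> Pc; rewrite /sesqf.
have -> : y^t* *m P *m x = (x^t* *m P *m y)^t*.
  by rewrite !trmx_mul !map_mxM trmxCK Pc mulmxA.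
by rewrite !mxE.
Qed.

Lemma sesqf_real P x : P^t* = P -> sesqf P x x \is Num.real.
Proof. by move=> Pc; apply/CrealP; rewrite -sesqf_herm. Qed.

Lemma sesqf_gram m (L : 'M[C]_(m, n)) x : sesqf (L^t* *m L) x x = \sum_i `|(L *m x) i 0| ^+ 2.
Proof.
rewrite /sesqf; have -> : x^t* *m (L^t* *m L) *m x = (L *m x)^t* *m (L *m x).
  by rewrite trmx_mul map_mxM !mulmxA.
by rewrite mxE; apply: eq_bigr => i _; rewrite ![_ ord0 i]mxE normCKC.
Qed.

Lemma sesqf1 x : sesqf 1%:M x x = \sum_i `|x i 0| ^+ 2.
Proof.
have := sesqf_gram 1%:M x; rewrite mul1mx trmx1 map_mx1 mulmx1 => ->.
by apply: eq_bigr => i _.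
Qed.

Lemma sum_normsq_eq0 m (x : 'cV[C]_m) : (\sum_i `|x i 0| ^+ 2 == 0) = (x == 0).
Proof.
apply/eqP/eqP => [e|->]; last by rewrite big1 // => i _; rewrite mxE normr0 expr0n.
apply/colP=> i; rewrite [RHS]mxE; apply/eqP; rewrite -normr_eq0 -sqrf_eq0.
have h k : true -> 0 <= `|x k 0| ^+ 2 by move=> _; exact: exprn_ge0.
by rewrite (psumr_eq0P h e (i := i)).
Qed.

Lemma sum_normsq_ge0 m (x : 'cV[C]_m) : 0 <= \sum_i `|x i 0| ^+ 2.
Proof. by apply: sumr_ge0 => i _; exact: exprn_ge0. Qed.

(** For nonzero [z] the phase [i z^* / |z|] moves [z] to [i |z|]. It serves to remove the real part
    of the cross term of a Hermitian form. *)
Lemma imaginary_phase (z : C) : exists u : C, u * u^* = 1 /\ u * z + (u * z)^* = 0.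
Proof.
have [->|z0] := eqVneq z 0.
  by exists 1; rewrite conjC1 mulr1 mulr0 conjC0 addr0.
have nz : `|z| != 0 by rewrite normr_eq0.
exists ('i * z^* / `|z|); split.
  rewrite !rmorphM fmorphV /= conjCi conjCK conj_normC.
  have -> : 'i * z^* / `|z| * (- 'i * z / `|z|) = - ('i * 'i) * (z * z^*) / (`|z| * `|z|).
    by field.
  by rewrite -expr2 sqrCi opprK mul1r -normCK expr2 divff // mulf_neq0.
have -> : 'i * z^* / `|z| * z = 'i * `|z|.
  transitivity ('i * (`|z| ^+ 2) / `|z|); first by rewrite normCK; ring.
  by rewrite expr2 mulrA mulfK.
by rewrite rmorphM /= conjCi conj_normC mulNr subrr.
Qed.

End SesquilinearForm.

Section RealForm.
Variables (R : realType) (n : nat).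
Local Notation C := R[i].
Implicit Types (P Q T : 'M[C]_n) (x y : 'cV[C]_n).

Local Notation "a %:C" := (real_complex R a).
Definition rform P x : R := complex.Re (sesqf P x x).

Lemma rformE P x : P^t* = P -> sesqf P x x = (rform P x)%:C.
Proof. by move=> Pc; rewrite /rform RRe_real // sesqf_real. Qed.

Lemma conj_rc (a : R) : (a%:C)^* = a%:C.
Proof. by apply/CrealP; apply/complex_realP; exists a. Qed.

Lemma rform_comb P x y (a b : R) : P^t* = P ->
  rform P (a%:C *: x + b%:C *: y) =
  a ^+ 2 * rform P x + b ^+ 2 * rform P y + a * b * complex.Re (sesqf P x y + (sesqf P x y)^*).
Proof.
move=> Pc; apply: complexI; rewrite -rformE // !sesqfDl !sesqfDr !sesqfZl !sesqfZr !conj_rc.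
rewrite (sesqf_herm x y Pc) !rformE // !rmorphD !rmorphM /=.
have cr : sesqf P x y + (sesqf P x y)^* \is Num.real.
  by apply/CrealP; rewrite rmorphD /= conjCK addrC.
rewrite (RRe_real cr).
move: (_%:C) (_%:C) (sesqf P x y) (_^*) (_%:C) (_%:C) => *; ring.
Qed.

(** Multiplying [y] by a phase changes neither form at [y]. The phase is chosen to remove the cross
    term of [Q] on the real span of the two vectors; the sign that remains free makes the cross term
    [rho] of [P] nonpositive. *)
Lemma phase_adjust P Q x y : P^t* = P -> Q^t* = Q ->
  exists y' rho, [/\ rform P y' = rform P y, rform Q y' = rform Q y, rho <= 0 &
   forall a b : R, rform Q (a%:C *: x + b%:C *: y') = a ^+ 2 * rform Q x + b ^+ 2 * rform Q y /\
     rform P (a%:C *: x + b%:C *: y') = a ^+ 2 * rform P x + b ^+ 2 * rform P y + a * b * rho].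
Proof.
move=> Pc Qc; have [u [uu uQ]] := imaginary_phase (sesqf Q x y).
pose rho u := complex.Re (sesqf P x (u *: y) + (sesqf P x (u *: y))^*).
have [v [vv vQ vrho]] : exists v,
    [/\ v * v^* = 1, v * sesqf Q x y + (v * sesqf Q x y)^* = 0 & rho v <= 0].
  have [h|/ltW h] := lerP (rho u) 0; first (exists u; split; [exact: uu | exact: uQ | exact: h]).
  exists (- u); split; first by rewrite rmorphN mulrNN.
    by rewrite mulNr rmorphN -opprD uQ oppr0.
  by rewrite /rho scaleNr -scaleN1r sesqfZr mulN1r rmorphN -opprD raddfN oppr_le0.
have rqv T : rform T (v *: y) = rform T y.
  by rewrite /rform sesqfZl sesqfZr mulrA [v^* * v]mulrC vv mul1r.
exists (v *: y), (rho v); split=> // a b; rewrite !rform_comb // !rqv; split=> //.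
by rewrite sesqfZr vQ raddf0 mulr0 addr0.
Qed.

End RealForm.

(** * Isotropic vectors and Finsler's lemma *)

Section Finsler.
Variables (R : realType).
Local Notation C := R[i].
Local Notation "a %:C" := (real_complex R a).

Lemma rformD n (P Q : 'M[C]_n) x : rform (P + Q) x = rform P x + rform Q x.
Proof. by rewrite /rform sesqfDm raddfD. Qed.

Lemma rformZ n a (P : 'M[C]_n) x : rform (a%:C *: P) x = a * rform P x.
Proof. by rewrite /rform sesqfZm; case: (sesqf _ _ _) => u v /=; rewrite mul0r subr0. Qed.

Lemma rform0 n (P : 'M[C]_n) : rform P 0 = 0.
Proof. by rewrite /rform /sesqf mulmx0 mxE. Qed.

Lemma rformZv n (P : 'M[C]_n) (a : R) x : rform P (a%:C *: x) = a ^+ 2 * rform P x.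
Proof.
rewrite /rform sesqfZl sesqfZr conj_rc mulrA.
by case: (sesqf _ _ _) => u v /=; ring.
Qed.

Lemma gram_herm m n (L : 'M[C]_(m, n)) : (L^t* *m L)^t* = L^t* *m L.
Proof. by rewrite trmx_mul map_mxM trmxCK. Qed.

Lemma rform_gram_ge0 m n (L : 'M[C]_(m, n)) x : 0 <= rform (L^t* *m L) x.
Proof. by rewrite -lecR -rformE ?gram_herm // sesqf_gram sum_normsq_ge0. Qed.

Lemma rform_gram_eq0 m n (L : 'M[C]_(m, n)) x : (rform (L^t* *m L) x == 0) = (L *m x == 0).
Proof.
rewrite -sum_normsq_eq0 -sesqf_gram rformE ?gram_herm //.
by apply/eqP/eqP => [->//|/complexI].
Qed.

(** On the plane of [phase_adjust], [Q] is diagonal, so the weights [a^2 = - Q(y)] and [b^2 = Q(x)]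
    cancel it, and the cross term can only lower [P]. *)
Lemma isotropic_of_indefinite n (P Q : 'M[C]_n) x y : P^t* = P -> Q^t* = Q ->
    0 < rform Q x -> rform Q y < 0 ->
  exists2 w, w != 0 & rform Q w = 0 /\ rform P w <= rform Q x * rform P y - rform Q y * rform P x.
Proof.
move=> Pc Qc Qx Qy; have [y' [rho [Py' Qy' rho0 comb]]] := phase_adjust x y Pc Qc.
pose a := Num.sqrt (- rform Q y); pose b := Num.sqrt (rform Q x).
have a2 : a ^+ 2 = - rform Q y by rewrite sqr_sqrtr // oppr_ge0 ltW.
have b2 : b ^+ 2 = rform Q x by rewrite sqr_sqrtr // ltW.
have [Qw Pw] := comb a b.
exists (a%:C *: x + b%:C *: y'); last first.
  have : a * b * rho <= 0 by rewrite mulr_ge0_le0 // mulr_ge0 ?sqrtr_ge0.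
  rewrite Qw Pw a2 b2; move: (rform Q x) (rform Q y) (rform P x) (rform P y) (a * b * rho).
  by move=> qx qy px py c c0; clear -c0; split; [ring | lra].
(* If the combination vanished, [a x] and [b y'] would be opposite, so [Q] would agree on them,
   although its values there have opposite signs. *)
apply/eqP => /eqP; rewrite addr_eq0 => /eqP e.
have := rformZv Q a x; rewrite e -scaleNr -rmorphN rformZv sqrrN Qy' a2 b2.
move: (rform Q x) (rform Q y) Qx Qy => qx qy qx0 qy0 h; clear -qx0 qy0 h; nra.
Qed.

Lemma isotropic_common n (P Q : 'M[C]_n) x y : P^t* = P -> Q^t* = Q ->
    rform Q x = 0 -> rform Q y = 0 -> 0 < rform P x -> rform P y < 0 ->
  exists2 w, w != 0 & rform Q w = 0 /\ rform P w = 0.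
Proof.
move=> Pc Qc Qx Qy Px Py; have [y' [rho [Py' Qy' rho0 comb]]] := phase_adjust x y Pc Qc.
pose D := rho ^+ 2 - 4 * rform P x * rform P y.
have D0 : 0 <= D.
  rewrite /D; move: (rform P x) (rform P y) Px Py (sqr_ge0 rho) => px py h1 h2 h3.
  by clear -h1 h2 h3; nra.
(* A root of [P(x) a^2 + rho a + P(y)], the value of [P] at [a x + y']; [Q] vanishes on this whole
   plane. *)
pose a := (- rho + Num.sqrt D) / (2 * rform P x).
have aE : 2 * rform P x * a = - rho + Num.sqrt D.
  by rewrite /a mulrC divfK // mulf_neq0 ?pnatr_eq0 // gt_eqF.
have sD : Num.sqrt D ^+ 2 = D by rewrite sqr_sqrtr.
have [Qw Pw] := comb a 1.
exists (a%:C *: x + 1%:C *: y'); last first.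
  rewrite Qw Pw Qx Qy; split; first by rewrite !mulr0 addr0.
  have : (2 * rform P x * a + rho) ^+ 2 = D by rewrite aE addrAC addNr add0r.
  rewrite /D => e; apply: (@mulfI _ (4 * rform P x)).
    by rewrite mulf_neq0 ?pnatr_eq0 // gt_eqF.
  by move: (rform P x) (rform P y) e => px py h; clear -h; rewrite mulr0; nra.
apply/eqP => /eqP; rewrite addr_eq0 => /eqP e.
have := rformZv P a x; rewrite e -scaleNr -rmorphN rformZv sqrrN Py'.
by move: (rform P x) (rform P y) (sqr_ge0 a) Px Py => px py h1 h2 h3 h; clear -h1 h2 h3 h; nra.
Qed.

(* Rank-one induction: on the kernel of the last rows, split off the [T]-orthogonal
   complement of the kernel of all rows, which is at most a line. *)
Lemma finsler m n (L : 'M[C]_(m, n)) (T : 'M[C]_n) : T^t* = T ->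
    (forall x, x != 0 -> L *m x = 0 -> 0 < rform T x) ->
  exists2 s, 0 <= s & forall x, x != 0 -> 0 < rform T x + s * rform (L^t* *m L) x.
Proof.
elim: m n L T => [|m IHm] n L T Tc TL.
  exists 0 => // x x0; rewrite mul0r addr0; apply: TL => //.
  by apply/matrixP; case.
move: L TL; rewrite -[m.+1]add1n => L; rewrite -(vsubmxK L).
move: (usubmx L) (dsubmx L) => l L' {L} TL.
have Lx x : col_mx l L' *m x = 0 <-> l *m x = 0 /\ L' *m x = 0.
  rewrite mul_col_mx; split=> [|[-> ->]]; last exact: col_mx0.
  by move=> e; apply: eq_col_mx; rewrite e col_mx0.
have gramE x : rform ((col_mx l L')^t* *m col_mx l L') x =
    rform (l^t* *m l) x + rform (L'^t* *m L') x.
  by rewrite -rformD tr_col_mx map_row_mx mul_row_col.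
pose s0ok s0 := forall x, x != 0 -> L' *m x = 0 -> 0 < rform T x + s0 * rform (l^t* *m l) x.
(* Only the row [l] on the kernel of [L'] needs treatment: the induction hypothesis then applies to
   [T + s0 l^H l]. *)
suff [s0 s00 Ts0] : exists2 s0, 0 <= s0 & s0ok s0.
  have T'c : (T + s0%:C *: (l^t* *m l))^t* = T + s0%:C *: (l^t* *m l).
    by rewrite linearD map_mxD linearZ map_mxZ /= conj_rc gram_herm Tc.
  have [|s1 s10 Ts1] := IHm _ L' _ T'c.
    by move=> x x0 /(Ts0 x x0); rewrite rformD rformZ.
  exists (s0 + s1) => [|x x0]; first exact: addr_ge0.
  have := Ts1 x x0; rewrite gramE rformD rformZ.
  have := rform_gram_ge0 l x; have := rform_gram_ge0 L' x; clear -s00 s10.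
  move: (rform T x) (rform _ x) (rform _ x) => t u v u0 v0 h; nra.
have [Ll|] := boolP (kermx L'^T <= kermx l^T)%MS.
  exists 0 => // x x0 L'x; rewrite mul0r addr0; apply: TL => //; apply/Lx; split=> //.
  have /submx_trans/(_ Ll)/sub_kermxP : (x^T <= kermx L'^T)%MS.
    by apply/sub_kermxP; rewrite -trmx_mul L'x trmx0.
  by move=> e; apply: trmx_inj; rewrite trmx_mul e trmx0.
move=> /row_subPn[i /sub_kermxP li].
pose x0 := (row i (kermx L'^T))^T.
have L'x0 : L' *m x0 = 0.
  by apply: trmx_inj; rewrite trmx_mul trmxK -row_mul mulmx_ker row0 trmx0.
have lx0 : (l *m x0) 0 0 != 0.
  apply/eqP=> e; apply: li; apply: trmx_inj; rewrite trmx_mul trmxK -/x0 trmx0.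
  by apply/matrixP=> a b; rewrite !ord1 e mxE.
clearbody x0.
pose W := (row_base (kermx (col_mx l L')^T))^T.
have LW : col_mx l L' *m W = 0.
  apply: trmx_inj; rewrite trmx_mul trmxK trmx0; apply/sub_kermxP.
  by rewrite eq_row_base.
have Winj g : W *m g = 0 -> g = 0.
  move=> /(congr1 trmx); rewrite trmx_mul trmxK trmx0 => e; apply: trmx_inj; rewrite trmx0.
  by apply: (row_free_inj (row_base_free _)); rewrite e mul0mx.
have Wsurj x : col_mx l L' *m x = 0 -> exists g, x = W *m g.
  move=> Lx0; have /submxP[D e] : (x^T <= row_base (kermx (col_mx l L')^T))%MS.
    by rewrite eq_row_base; apply/sub_kermxP; rewrite -trmx_mul Lx0 trmx0.
  by exists D^T; apply: trmx_inj; rewrite trmx_mul !trmxK.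
pose G := W^t* *m T *m W.
have Gu : G \in unitmx.
  rewrite unitmxE unitfE -det_tr; apply/negP=> /det0P[g g0].
  move=> /(congr1 trmx); rewrite trmx_mul trmxK trmx0 => Gg.
  have gT0 : g^T != 0 by apply: contraNneq g0 => e; rewrite -[g]trmxK e trmx0.
  have Wg0 : W *m g^T != 0 by apply: contraNneq gT0 => /Winj ->.
  have LWg : col_mx l L' *m (W *m g^T) = 0 by rewrite mulmxA LW mul0mx.
  have := TL _ Wg0 LWg.
  rewrite /rform /sesqf trmx_mul map_mxM -!mulmxA (mulmxA T) (mulmxA (W^t*)) (mulmxA (W^t*)).
  by rewrite -/G Gg mulmx0 mxE ltxx.
(* [x0] is corrected by a vector of the kernel of all rows so as to become [T]-orthogonal to that
   kernel. [G] is the matrix of [T] there, invertible by definiteness. *)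
pose y := x0 - W *m (invmx G *m (W^t* *m T *m x0)).
have L'W : L' *m W = 0.
  by apply/matrixP => a b; have /matrixP/(_ (rshift 1 a) b) := LW; rewrite mul_col_mx col_mxEd !mxE.
have lW : l *m W = 0.
  by apply/matrixP => a b; have /matrixP/(_ (lshift m a) b) := LW; rewrite mul_col_mx col_mxEu !mxE.
have L'y : L' *m y = 0 by rewrite mulmxBr L'x0 mulmxA L'W mul0mx subr0.
have ly : (l *m y) 0 0 != 0 by rewrite mulmxBr (mulmxA l) lW mul0mx subr0.
have WTy : W^t* *m T *m y = 0.
  by rewrite mulmxBr mulmxA -/G mulmxA mulmxV // mul1mx subrr.
clearbody y.
pose g := rform (l^t* *m l) y; pose t := rform T y.
have g0 : 0 < g.
  rewrite lt_neqAle rform_gram_ge0 eq_sym rform_gram_eq0 andbT.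
  by apply: contraNneq ly => ->; rewrite mxE.
(* With this constant the value at [y] is [t + |t| + g], which is positive. *)
exists (`|t| / g + 1).
  by rewrite addr_ge0 ?ler01 // divr_ge0 // ltW.
move=> x xn0 L'x; pose k := (l *m x) 0 0 / (l *m y) 0 0.
pose w := x - k *: y.
have lw : l *m w = 0.
  apply/matrixP=> a b; rewrite !ord1 mulmxBr -scalemxAr [LHS]mxE [X in _ + X]mxE [X in - X]mxE.
  by rewrite /k divfK // subrr mxE.
have L'w : L' *m w = 0 by rewrite mulmxBr -scalemxAr L'x L'y scaler0 subr0.
have [h wE] := Wsurj _ w (proj2 (Lx _ w) (conj lw L'w)).
have xE : x = w + k *: y by rewrite subrK.
have Twy : sesqf T w y = 0.
  by rewrite /sesqf wE trmx_mul map_mxM -!mulmxA (mulmxA (W^t*)) WTy mulmx0 mxE.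
have lwy z : sesqf (l^t* *m l) z w = 0 by rewrite /sesqf -!mulmxA lw !mulmx0 mxE.
clearbody w.
have [kk kkE] : exists kk : R, k^* * k = kk%:C.
  by apply/complex_realP; rewrite -normCKC rpredX // normr_real.
have kk0 : 0 <= kk by rewrite -lecR -kkE -normCKC exprn_ge0.
have Tx : rform T x = rform T w + kk * t.
  apply: complexI; rewrite -rformE // xE sesqfDl !sesqfDr !sesqfZl !sesqfZr.
  by rewrite (sesqf_herm w y Tc) Twy conjC0 !mulr0 add0r addr0 mulrA kkE !rformE // rmorphD rmorphM.
have lx : rform (l^t* *m l) x = kk * g.
  have lc := gram_herm l.
  apply: complexI; rewrite -rformE // xE sesqfDl !sesqfDr !sesqfZl !sesqfZr.
  by rewrite (sesqf_herm y w lc) !lwy conjC0 !mulr0 !add0r mulrA kkE !rformE // rmorphM.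
rewrite Tx lx.
have tg : 0 < t + (`|t| / g + 1) * g.
  rewrite mulrDl divfK ?gt_eqF // mul1r; have := ler_norm (- t); rewrite normrN.
  by move: g0; move: `|t| (t) (g) => n0 t' g'; clear; lra.
have [w0|wn0] := eqVneq w 0.
  have kn0 : 0 < kk.
    rewrite lt_neqAle kk0 andbT; apply: contraNneq xn0 => e.
    have : `|k| ^+ 2 == 0 by rewrite normCKC kkE -e.
    by rewrite sqrf_eq0 normr_eq0 xE w0 add0r => /eqP->; rewrite scale0r.
  rewrite w0 rform0 add0r mulrCA -mulrDr; exact: mulr_gt0.
have Tw : 0 < rform T w by apply: TL => //; apply/Lx.
by rewrite mulrCA -addrA -mulrDr ltr_pwDl // mulr_ge0 // ltW.
Qed.

End Finsler.

Lemma row_diag_mul (K : pzSemiRingType) m n (d : 'rV[K]_m) (V : 'M[K]_(m, n)) i :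
  row i (diag_mx d *m V) = d 0 i *: row i V.
Proof. by apply/rowP=> k; rewrite mxE mul_diag_mx !mxE. Qed.

(** * Spectral decomposition and definiteness *)

Section Spectral.
Variables (C : numClosedFieldType) (n : nat).
Implicit Types (S V : 'M[C]_n) (d : 'rV[C]_n).

Lemma herm_spectral S : S^t* = S -> exists V d,
  [/\ V *m V^t* = 1%:M, S = V^t* *m diag_mx d *m V, V *m S = diag_mx d *m V
    & forall i, d 0 i = sesqf S ((row i V)^t*) ((row i V)^t*)].
Proof.
move=> Sc; have /orthomx_spectralP : S \is normalmx by apply/normalmxP; rewrite Sc.
have Vu := spectral_unitarymx S; rewrite invmx_unitary //.
move: (spectralmx S) (spectral_diag S) Vu => V d /unitarymxP VV SE.
have VS : V *m S = diag_mx d *m V by rewrite {1}SE !mulmxA VV mul1mx.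
exists V, d; split=> // i; rewrite /sesqf trmxCK -row_mul VS row_diag_mul -scalemxAl mxE.
have -> : row i V *m (row i V)^t* = 1%:M.
  apply/matrixP=> a b; rewrite !ord1; have /matrixP/(_ i i) := VV.
  by rewrite !mxE !eqxx => <-; apply: eq_bigr => k _; rewrite !mxE.
by rewrite !mxE mulr1.
Qed.

Lemma psd_gram S V d :
    S = V^t* *m diag_mx d *m V -> (forall i, 0 <= d 0 i) ->
  exists L : 'M[C]_n, S = L^t* *m L.
Proof.
move=> SE d0; exists (diag_mx (\row_i sqrtC (d 0 i)) *m V).
rewrite trmx_mul map_mxM tr_diag_mx map_diag_mx mulmxA -(mulmxA (V^t*)) mulmx_diag SE.
congr (_ *m diag_mx _ *m _); apply/rowP=> i; rewrite !mxE /=.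
have /CrealP -> : sqrtC (d 0 i) \is Num.real by rewrite ger0_real // sqrtC_ge0.
by rewrite -expr2 sqrtCK.
Qed.

End Spectral.

Section DefiniteCombination.
Variables (R : realType) (n : nat).
Local Notation C := R[i].
Local Notation "a %:C" := (real_complex R a).
Implicit Types (P Q S T : 'M[C]_n) (x y : 'cV[C]_n).

(** A semidefinite [S] is [L^H L], so its isotropic vectors form the kernel of [L] and [finsler]
    applies. *)
Lemma psd_add_definite S T : S^t* = S -> T^t* = T -> (forall x, 0 <= rform S x) ->
    (forall x, x != 0 -> rform S x = 0 -> 0 < rform T x) ->
  exists2 s, 0 <= s & forall x, x != 0 -> 0 < rform T x + s * rform S x.
Proof.
move=> Sc Tc S0 ST; have [V [d [VV SE VS dE]]] := herm_spectral Sc.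
have [|L LE] := psd_gram SE; first by move=> i; rewrite dE rformE // ler0c.
rewrite LE in ST *; apply: finsler => // x x0 Lx; apply: ST => //.
by apply/eqP; rewrite rform_gram_eq0 Lx.
Qed.

(** A negative eigenvalue [- t] makes the determinant vanish at [t], and the case [t = 0] excludes
    the eigenvalue zero. In this form definiteness can be transferred through the base
    polynomial. *)
Lemma definiteP P : P^t* = P ->
  (forall x, x != 0 -> 0 < rform P x) <-> (forall t : R, 0 <= t -> \det (P + (t%:C)%:M) != 0).
Proof.
move=> Pc; split=> [Ppos t t0|detP].
  apply/negP; rewrite -det_tr => /det0P[v v0 vP].
  have Pv : (P + (t%:C)%:M) *m v^T = 0 by apply: trmx_inj; rewrite trmx_mul trmxK vP trmx0.
  have x0 : v^T != 0 by apply: contraNneq v0 => e; rewrite -[v]trmxK e trmx0.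
  move: (v^T) x0 Pv => x x0 Px {v v0 vP}.
  have := Ppos x x0; have : rform (P + (t%:C)%:M) x = 0.
    by rewrite /rform /sesqf -mulmxA Px mulmx0 mxE.
  rewrite rformD -scalemx1 rformZ; have : 0 <= rform 1%:M x.
    by rewrite -lecR -rformE ?sesqf1 ?sum_normsq_ge0 // trmx1 map_mx1.
  move: (rform P x) (rform _ x) => p q; clear -t0; nra.
have [V [d [VV PE VP dE]]] := herm_spectral Pc.
have [i|L LE] := psd_gram PE.
  rewrite dE rformE // ler0c leNgt; apply/negP=> di.
  have /negP := detP _ (ltW (etrans (oppr_gt0 _) di)); apply; apply/det0P.
  exists (row i V).
    apply/eqP=> r0; have := congr1 (row i) VV; rewrite row_mul r0 mul0mx => /rowP/(_ i).
    by rewrite !mxE eqxx => /eqP; rewrite eq_sym oner_eq0.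
  rewrite mulmxDr -row_mul VP row_diag_mul mul_mx_scalar.
  set z := rform _ _; have -> : (- z)%:C = - d 0 i by rewrite rmorphN dE rformE.
  by rewrite scaleNr subrr.
move=> x x0; rewrite LE lt_neqAle rform_gram_ge0 eq_sym rform_gram_eq0 andbT.
apply: contraNneq x0 => Lx; have dP : \det P != 0.
  have := detP 0 (lexx _); have -> // : P + ((0 : R)%:C)%:M = P.
  by apply/matrixP=> i j; rewrite !mxE mul0rn addr0.
have Px : P *m x = 0 by rewrite LE -mulmxA Lx mulmx0.
by apply/eqP; apply: (mulmx_Icancel dP); rewrite Px mulmx0.
Qed.

End DefiniteCombination.

(** * Positive definite combinations of two Hermitian forms *)

Section NumericalRange.
Variables (R : realType).
Local Notation C := R[i].
Local Notation "a %:C" := (real_complex R a).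

Section Combination.
Variable n : nat.
Implicit Types (P Q : 'M[C]_n) (x y : 'cV[C]_n).

Lemma definite_of_semidefinite P Q (a b a' b' : R) : P^t* = P -> Q^t* = Q ->
    (forall x, 0 <= a * rform P x + b * rform Q x) ->
    (forall x, x != 0 -> a * rform P x + b * rform Q x = 0 ->
       0 < a' * rform P x + b' * rform Q x) ->
  exists a b : R, forall x, x != 0 -> 0 < a * rform P x + b * rform Q x.
Proof.
move=> Pc Qc S0 T0; pose comb u v := u%:C *: P + v%:C *: Q.
have combc u v : (comb u v)^t* = comb u v.
  by rewrite linearD map_mxD !linearZ !map_mxZ /= !conj_rc Pc Qc.
have rqc u v x : rform (comb u v) x = u * rform P x + v * rform Q x by rewrite rformD !rformZ.
have [x|x x0|s s0 sP] := psd_add_definite (combc a b) (combc a' b').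
- by rewrite rqc; exact: S0.
- by rewrite !rqc; exact: T0.
exists (a' + s * a), (b' + s * b) => x /sP; rewrite !rqc.
by move: (rform P x) (rform Q x) => p q; clear; congr (0 < _); ring.
Qed.

(* Finsler's lemma: [t] is the supremum of [- p / q] over the region [0 < q]. *)
Lemma definite_combination_pos P Q x0 : P^t* = P -> Q^t* = Q ->
    (forall x, x != 0 -> rform P x = 0 -> rform Q x = 0 -> False) ->
    rform Q x0 = 0 -> 0 < rform P x0 ->
  exists a b : R, forall x, x != 0 -> 0 < a * rform P x + b * rform Q x.
Proof.
move=> Pc Qc PQ Qx0 Px0.
(* [P] has one sign on the isotropic vectors of [Q]; a change of sign would produce a common
   zero. *)
have pos y : y != 0 -> rform Q y = 0 -> 0 < rform P y.
  move=> y0 Qy; rewrite ltNge le_eqVlt; apply/negP=> /orP[/eqP Py|Py].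
    exact: PQ Py Qy.
  have [w w0 [Qw Pw]] := isotropic_common Pc Qc Qx0 Qy Px0 Py.
  exact: PQ Pw Qw.
(* The quotients [- P / Q] where [Q] is positive lie strictly below those where it is negative:
   [isotropic_of_indefinite] yields an isotropic vector of [Q], at which [P] is positive. *)
have sep x y : 0 < rform Q x -> rform Q y < 0 -> - rform P x / rform Q x < - rform P y / rform Q y.
  move=> Qx Qy; have [w w0 [Qw Pw]] := isotropic_of_indefinite Pc Qc Qx Qy.
  have := lt_le_trans (pos w w0 Qw) Pw.
  rewrite ltr_pdivrMr // mulrAC ltr_ndivlMr //.
  by move: (rform P x) (rform Q x) (rform P y) (rform Q y) => px qx py qy h; clear -h; nra.
have defn := definite_of_semidefinite Pc Qc.
(* If [Q] takes values of one sign only, [Q] or [- Q] is semidefinite and [P] is positive on its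
   nonzero isotropic vectors. *)
have [[y1 Qy1]|noy] := pselect (exists y, rform Q y < 0); last first.
  apply: (defn 0 1 1 0) => [x|x xn0]; rewrite !mul0r !mul1r ?add0r ?addr0.
    by rewrite leNgt; apply/negP=> h; apply: noy; exists x.
  exact: pos.
have [[x1 Qx1]|nox] := pselect (exists x, 0 < rform Q x); last first.
  apply: (defn 0 (-1) 1 0) => [x|x xn0]; rewrite !mul0r ?mulN1r ?mul1r ?add0r ?addr0.
    by rewrite oppr_ge0 leNgt; apply/negP=> h; apply: nox; exists x.
  by move/eqP; rewrite oppr_eq0 => /eqP; exact: pos.
pose E : set R := [set e | exists2 x, 0 < rform Q x & e = - rform P x / rform Q x]%classic.
have E0 : (E !=set0)%classic by exists (- rform P x1 / rform Q x1), x1.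
have ubE y : rform Q y < 0 -> ubound E (- rform P y / rform Q y).
  by move=> Qy e [x Qx ->]; apply/ltW/sep.
have supE : has_sup E by split=> //; exists (- rform P y1 / rform Q y1); exact: ubE.
pose t := sup E.
have psd x : 0 <= 1 * rform P x + t * rform Q x.
  rewrite mul1r; case: (ltrgt0P (rform Q x)) => Qx.
  - have : - rform P x / rform Q x <= t by apply: sup_upper_bound => //; exists x.
    by rewrite ler_pdivrMr // -subr_ge0 opprK addrC.
  - have : t <= - rform P x / rform Q x by apply: ge_sup => //; exact: ubE.
    by rewrite ler_ndivlMr // -subr_ge0 opprK addrC.
  - rewrite Qx mulr0 addr0; have [->|xn0] := eqVneq x 0; first by rewrite rform0.
    exact: ltW (pos x xn0 Qx).
have kerQ x : x != 0 -> 1 * rform P x + t * rform Q x = 0 -> rform Q x != 0.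
  move=> xn0 e; apply/eqP=> Qx; move: e; rewrite Qx mulr0 addr0 mul1r => Px.
  exact: PQ xn0 Px Qx.
have kert x : x != 0 -> 1 * rform P x + t * rform Q x = 0 -> t = - rform P x / rform Q x.
  move=> xn0 e; apply: (mulIf (kerQ x xn0 e)); rewrite divfK ?kerQ //.
  by apply/eqP; rewrite -subr_eq0 opprK addrC -[X in X + _]mul1r e.
(* By strictness in [sep], the value [t] cannot be attained on both sides. So [Q] has a constant
   sign on the nonzero zeros of [P + t Q], and [Q] or [- Q] serves as the form positive there. *)
have [[x2 [x2n0 x2k Qx2]]|nok] :=
    pselect (exists x, [/\ x != 0, 1 * rform P x + t * rform Q x = 0 & rform Q x < 0]).
  apply: (defn 1 t 0 (-1)) => // x xn0 e.
  rewrite mul0r add0r mulN1r oppr_gt0.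
  have := kerQ x xn0 e; case: ltrgt0P => // Qx _.
  by have := sep x x2 Qx Qx2; rewrite -kert // -kert // ltxx.
apply: (defn 1 t 0 1) => // x xn0 e; rewrite mul0r add0r mul1r.
have := kerQ x xn0 e; case: ltrgt0P => // Qx _.
by case: nok; exists x.
Qed.

(** If [Q] has a nonzero isotropic vector, [P] does not vanish there, and the case of a positive
    value applies to [P] or [- P]. Otherwise [Q] itself is definite, for an indefinite form has a
    nonzero isotropic vector. *)
Lemma definite_combination P Q : P^t* = P -> Q^t* = Q ->
    (forall x, x != 0 -> rform P x = 0 -> rform Q x = 0 -> False) ->
  exists a b : R, forall x, x != 0 -> 0 < a * rform P x + b * rform Q x.
Proof.
move=> Pc Qc PQ.
have NPc : (- P)^t* = - P by rewrite linearN map_mxN /= Pc.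
have rformN x : rform (- P) x = - rform P x.
  by rewrite -scaleN1r -[-1]/(- 1%:C) -rmorphN rformZ mulN1r.
have [[x0 [x0n0 Qx0]]|noQ] := pselect (exists x, x != 0 /\ rform Q x = 0).
  case: (ltrgt0P (rform P x0)) => Px0.
  - exact: (definite_combination_pos (x0 := x0)).
  - have [|||a [b ab]] := definite_combination_pos (x0 := x0) NPc Qc.
    + by move=> x xn0; rewrite rformN => /eqP; rewrite oppr_eq0 => /eqP; exact: PQ.
    + by [].
    + by rewrite rformN oppr_gt0.
    by exists (- a), b => x /ab; rewrite rformN mulrN mulNr.
  - by case: (PQ x0).
have [[y [yn0 Qy]]|noy] := pselect (exists y, y != 0 /\ rform Q y < 0); last first.
  exists 0, 1 => x xn0; rewrite mul0r add0r mul1r; case: ltrgt0P => // Qx.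
    by case: noy; exists x.
  by case: noQ; exists x.
exists 0, (-1) => x xn0; rewrite mul0r add0r mulN1r oppr_gt0; case: ltrgt0P => // Qx.
  have [w w0 [Qw _]] := isotropic_of_indefinite Pc Qc Qx Qy.
  by case: noQ; exists w.
by case: noQ; exists x.
Qed.

End Combination.
End NumericalRange.

(** * The base polynomial determines the numerical range *)

Local Open Scope classical_set_scope.

(** Scalar shifts of [H1] and [H2] are absorbed into the third variable, so the determinants tested
    by [definiteP] are values of the base polynomial. *)
Lemma base_poly_det (C : numClosedFieldType) n (A : 'M[C]_n) a b t (r i : C) :
  \det (a *: (H1 A - r%:M) + b *: (H2 A - i%:M) + t%:M) =
  (base_poly A).@[fun k => nth 0 [:: a; b; t - a * r - b * i] k].
Proof.
rewrite /meval mmap_base_poly !inordK //= !map_mx_id //; congr (\det _).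
apply/matrixP=> k l; rewrite !mxE.
by case: (k == l); rewrite ?mulr1n ?mulr0n; ring.
Qed.

(** Membership becomes a common zero of two Hermitian forms; a nonzero vector can be normalised
    because both forms scale by the same factor. *)
Lemma numerical_rangeP (C : numClosedFieldType) n (A : 'M[C]_n) z :
  numerical_range A z <-> exists x : 'cV[C]_n, [/\ x != 0,
    sesqf (H1 A - ('Re z)%:M) x x = 0 & sesqf (H2 A - ('Im z)%:M) x x = 0].
Proof.
have sesqfB (P : 'M[C]_n) c x : sesqf (P - c%:M) x x = sesqf P x x - c * sesqf 1%:M x x.
  rewrite sesqfDm; congr (_ + _).
  by rewrite /sesqf mulmxN mulNmx mul_mx_scalar mulmx1 -scalemxAl !mxE.
have sesqfA x : sesqf A x x = sesqf (H1 A) x x + 'i * sesqf (H2 A) x x.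
  by rewrite {1}(H12K A) sesqfDm sesqfZm.
have cdotE (x y : 'cV[C]_n) (P : 'M[C]_n) : cdot (P *m x) y = sesqf P y x.
  by rewrite /cdot /sesqf mulmxA.
have cdot1 (x : 'cV[C]_n) : cdot x x = sesqf 1%:M x x by rewrite -cdotE mul1mx.
have zE : z = 'Re z + 'i * 'Im z by exact: Crect.
split=> [[x /= nx xz]|[x [xn0 P0 Q0]]].
  have x1 : sesqf 1%:M x x = 1.
    by rewrite -cdot1 -[LHS]sqrtCK; rewrite /cnorm in nx; rewrite nx expr1n.
  have xn0 : x != 0.
    by apply: contra_eqN x1 => /eqP->; rewrite /sesqf mulmx0 mxE eq_sym oner_eq0.
  exists x; rewrite !sesqfB x1 !mulr1.
  have H1r := sesqf_real x (H1_herm A); have H2r := sesqf_real x (H2_herm A).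
  have e : sesqf (H1 A) x x + 'i * sesqf (H2 A) x x = z by rewrite -sesqfA -cdotE.
  have := congr1 (fun u => 'Re u) e; have := congr1 (fun u => 'Im u) e.
  rewrite Re_rect // Im_rect // => -> ->.
  by rewrite !subrr.
have n0 : 0 < sesqf 1%:M x x.
  by rewrite lt_neqAle sesqf1 sum_normsq_ge0 eq_sym sum_normsq_eq0 xn0.
have s0 : sqrtC (sesqf 1%:M x x) != 0 by rewrite sqrtC_eq0 gt_eqF.
set s := sqrtC _ in s0; have sr : s^* = s.
  by apply/CrealP; rewrite ger0_real // sqrtC_ge0 ltW.
have ss P : sesqf P (s^-1 *: x) (s^-1 *: x) = sesqf P x x / sesqf 1%:M x x.
  by rewrite sesqfZl sesqfZr fmorphV /= sr -[in RHS](sqrtCK (sesqf 1%:M x x)) -/s expr2 invfM; ring.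
exists (s^-1 *: x) => /=.
  by rewrite /cnorm cdot1 ss divff ?gt_eqF // sqrtC1.
rewrite cdotE ss sesqfA; apply: (mulIf (lt0r_neq0 n0)); rewrite divfK ?gt_eqF //.
rewrite [in RHS]zE mulrDl -mulrA.
by move: P0 Q0; rewrite !sesqfB => /subr0_eq -> /subr0_eq ->.
Qed.

(** If [z] is outside the range of [B], the two forms of [B] at [z] have no common nonzero zero, so
    some real combination is positive definite. The equality of base polynomials makes the same
    combination definite for [A], which excludes the common zero that puts [z] in the range of
    [A]. *)
Lemma sub_numerical_range (R : realType) n (A B : 'M[R[i]]_n) :
  base_poly A = base_poly B -> numerical_range A `<=` numerical_range B.
Proof.
move=> eqAB z /numerical_rangeP[x [xn0 Ax Ax']]; apply: contrapT => nB.
pose P (D : 'M[R[i]]_n) := H1 D - ('Re z)%:M; pose Q (D : 'M[R[i]]_n) := H2 D - ('Im z)%:M.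
have Pc D : (P D)^t* = P D.
  by rewrite /P linearB map_mxB /= H1_herm tr_scalar_mx map_scalar_mx /= (CrealP (Creal_Re z)).
have Qc D : (Q D)^t* = Q D.
  by rewrite /Q linearB map_mxB /= H2_herm tr_scalar_mx map_scalar_mx /= (CrealP (Creal_Im z)).
have [|a [b ab]] := definite_combination (Pc B) (Qc B).
  move=> y yn0 Py Qy; apply: nB; apply/numerical_rangeP; exists y.
  have eP : sesqf (P B) y y = 0 by rewrite (rformE y (Pc B)) Py.
  have eQ : sesqf (Q B) y y = 0 by rewrite (rformE y (Qc B)) Qy.
  exact: And3 yn0 eP eQ.
pose S D := (real_complex R a) *: P D + (real_complex R b) *: Q D.
have Sc D : (S D)^t* = S D.
  by rewrite linearD map_mxD !linearZ !map_mxZ /= !conj_rc Pc Qc.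
have rformS D y : rform (S D) y = a * rform (P D) y + b * rform (Q D) y by rewrite rformD !rformZ.
have SB : forall y, y != 0 -> 0 < rform (S B) y by move=> y /ab; rewrite rformS.
have SA : forall y, y != 0 -> 0 < rform (S A) y.
  apply/(definiteP (Sc A)) => t t0.
  have dB := proj1 (definiteP (Sc B)) SB t t0.
  have detS (D : 'M[R[i]]_n) := base_poly_det D
    (real_complex R a) (real_complex R b) (real_complex R t) ('Re z) ('Im z).
  have detAB : \det (S A + (real_complex R t)%:M) = \det (S B + (real_complex R t)%:M).
    apply: etrans (detS A) _; apply: etrans _ (esym (detS B)).
    by rewrite eqAB.
  rewrite detAB.
  exact: dB.
by have := SA x xn0; rewrite rformS /rform Ax Ax' !mulr0 addr0 ltxx.
Qed.

Lemma eq_numerical_range (R : realType) n (A B : 'M[R[i]]_n) :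
  base_poly A = base_poly B -> numerical_range A = numerical_range B.
Proof.
move=> AB; apply/seteqP; split.
  exact: (sub_numerical_range AB).
exact: (sub_numerical_range (esym AB)).
Qed.

Lemma block_diagonal_base_poly (C : numClosedFieldType) n (A : 'M[C]_n) :
  poly_reducible (base_poly A) ->
  exists2 A' : 'M[C]_n, block_diagonal A' & base_poly A' = base_poly A.
Proof.
move=> /char_poly_reducible[p [q [cA p1 q1]]].
have [H [J [N [c g]]]] := reducing_form_exists (real_pencil_herm A) cA p1 q1.
have [K0 [K1 [K2 [[K0c KK K00 K01] [K1c K2c K01c K02c cK]]]]] :=
  reducing_form_split g (size_tr_sqr_real_pencil A).
have [|A' A'b A'F] := block_diagonal_of_projection (A := K1 + 'i *: K2) K0c KK K00 K01.
  by rewrite mulmxDr mulmxDl -scalemxAr -scalemxAl K01c K02c.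
exists A'; first exact: A'b.
apply: etrans A'F _; apply: base_poly_pencil.
apply: etrans cK; congr char_poly; rewrite /real_pencil (H1_rect K1c K2c).
by rewrite (H2_rect K1c K2c).
Qed.

Theorem corollary19 (R : realType) (n : nat) (A : 'M[R[i]]_n)
    (A_irr : unitarily_irreducible A)
    (FA_red : poly_reducible (base_poly A)) :
  exists A' : 'M[R[i]]_n,
    [/\ block_diagonal A',
        numerical_range A' = numerical_range A,
        base_poly A' = base_poly A
      & boundary_generating_curve A' = boundary_generating_curve A].
Proof.
have [A' A'b A'F] := block_diagonal_base_poly FA_red.
exists A'; split; [exact: A'b | exact: (eq_numerical_range A'F) | exact: A'F |].
by rewrite /boundary_generating_curve A'F.
Qed.
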